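(* For odd integers $n=2m+1\geq 3$, let $U_n$ and $V_n$ be the sets of critical points and of critical values, respectively, of $\mu:X_n\to\mathbb{R}$. Then: (i) $$|U_n|\sim 2^{2m-1}\left(-1+\frac{2m+1}{\sqrt{\pi m}}\right)\quad (m\to\infty).$$ (ii) $$|V_n|\sim\frac{n^2}{\pi^2}\quad (n\to\infty,\ n \text{ odd}).$$
   Context: $|\cdot|$ denotes cardinality, and $f(n)\sim g(n)$ $(n\to\infty)$ means $\lim_{n\to\infty}f(n)/g(n)=1$. $d(u,v)=\arccos(u\cdot v)$ denotes the spherical distance on the unit sphere $S^2\subset\mathbb{R}^3$. Set $$B_n:=\{((u_1,\dots,u_n),a)\in (S^2)^n\times(0,\pi) \mid d(u_i,u_{i+1})=a \text{ for } 1\leq i\leq n-1 \text{ and } d(u_n,u_1)=a\}.$$ $SO(3)$ acts on $B_n$ diagonally on the points $u_i$ and trivially on $a$, and $X_n:=B_n/SO(3)$. For odd $n$, $X_n$ is a smooth manifold of dimension $n-2$ (with $B_n$ regarded as a smooth submanifold of $(S^2)^n\times(0,\pi)$, on which $SO(3)$ acts freely). The smooth function $\mu:X_n\to\mathbb{R}$ is $\mu(P,a)=a$. *)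

(* Defs.v *)
From mathcomp Require Import all_boot all_order all_algebra finmap.
From mathcomp Require Import all_classical all_reals all_analysis.

Import Order.TTheory GRing.Theory Num.Theory.
Import numFieldNormedType.Exports.

Local Open Scope classical_set_scope.
Local Open Scope ring_scope.

Definition dot {R : realType} (u v : 'cV[R]_3) : R := \sum_i u i 0 * v i 0.

Definition sphere2 (R : realType) : set 'cV[R]_3 := [set u | dot u u = 1].

Definition sdist {R : realType} (u v : 'cV[R]_3) : R := acos (dot u v).

Definition SO3 (R : realType) : set 'M[R]_3 :=
  [set A | A *m A^T = 1%:M /\ \det A = 1].

Definition config (R : realType) (n : nat) : Type :=
  (('I_n -> 'cV[R]_3) * R)%type.

(* [ordS] is the cyclic successor on ['I_n], so the condition at the last
   index is d(u_n, u_1) = a. *)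
Definition Bn (R : realType) (n : nat) : set (config R n) :=
  [set p | [/\ forall i, sphere2 R (p.1 i),
               0 < p.2 < pi &
               forall i, sdist (p.1 i) (p.1 (ordS i)) = p.2]].

Definition rotate {R : realType} {n : nat} (A : 'M[R]_3) (p : config R n) :
    config R n :=
  (fun i => A *m p.1 i, p.2).

Definition orbitSO3 {R : realType} {n : nat} (p : config R n) :
    set (config R n) :=
  [set rotate A p | A in SO3 R].

(* The points of the quotient B_n / SO(3) are the orbits. *)
Definition Xn (R : realType) (n : nat) : set (set (config R n)) :=
  [set orbitSO3 p | p in Bn R n].

(* The second component is constant on an orbit, so [get] returns the only
   element of the image. *)
Definition mu {R : realType} {n : nat} (x : set (config R n)) : R :=
  get [set p.2 | p in x].

(* C^infinity on a neighbourhood of 0, coordinate by coordinate in the ambient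
   space (R^3)^n x R. *)
Definition smooth_near0 {R : realType} {n : nat} (g : R -> config R n) : Prop :=
  \forall t \near (0 : R), forall k : nat,
    (forall i j, derivable (derive1n k (fun s => (g s).1 i j 0)) t 1) /\
    derivable (derive1n k (fun s => (g s).2)) t 1.

(* Smooth curves of X_n (n odd), defined near the parameter 0.  Since B_n is an
   embedded submanifold of the ambient space, its smooth curves are the smooth
   ambient curves with values in B_n.  The projection B_n -> X_n is the quotient
   by a free smooth action of a compact Lie group, hence a principal bundle, so
   the smooth curves of X_n are those that locally lift to smooth curves of
   B_n. *)
Definition smooth_curveX {R : realType} {n : nat} (c : R -> set (config R n)) :
    Prop :=
  exists g : R -> config R n,
    [/\ smooth_near0 g,
        \forall t \near (0 : R), Bn R n (g t) &
        \forall t \near (0 : R), c t = orbitSO3 (g t)].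

(* x is critical when the differential of mu at x vanishes.  The tangent
   vectors at x are the velocities c'(0) of the smooth curves c with c(0) = x,
   and the differential maps c'(0) to (mu o c)'(0). *)
Definition critical_point {R : realType} {n : nat} (x : set (config R n)) :
    Prop :=
  Xn R n x /\
  forall c : R -> set (config R n), smooth_curveX c -> c 0 = x ->
    is_derive (0 : R) 1 (mu \o c) (0 : R).

Definition Un (R : realType) (n : nat) : set (set (config R n)) :=
  [set x | critical_point x].

Definition Vn (R : realType) (n : nat) : set R := [set mu x | x in Un R n].

(* [fset_set] is empty on infinite sets, so this is the cardinality of A when A
   is finite and 0 otherwise.  Hence f ~ g with f n = setcard (A n) entails that
   A n is finite for all large n. *)
Definition setcard {T : choiceType} (A : set T) : nat := #|` fset_set A|.

Definition asymp_equiv {R : realType} (F : set_system nat) (f g : nat -> R) :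
    Prop :=
  (fun n => f n / g n) @ F --> (1 : R).

(* Main.v *)
(* Let [u] be an equilateral spherical polygon with side [a].  If no vertex is
   bent, i.e. if for every [i] either u_{i+1} = u_{i-1} or
   u_{i+1} + u_{i-1} = 2 cos(a) u_i, then [u] lies on a great circle; its edges
   carry signs with sum [s] odd, and the sign-weighted sum of the derivatives of
   the constraints <u_i, u_{i+1}> = cos(a) reduces to s sin(a) a' = 0 along any
   curve, so [u] is critical.  If a vertex is bent, the open chain of the other
   vertices can be moved so that its sides become [a + t], and the bent vertex is
   recovered as the intersection of two circles: this is a smooth curve in [B_n]
   with a' = 1.

   Hence the critical points are the pairs (signs, k) with s > 0 and
   0 < k < s/2, of side 2 pi k / s.  Summing over the signs gives
   2 |U_n| + 4^m = (2m+1) C(2m, m), and Wallis' bounds give (i).  The critical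
   values are counted by the reduced fractions k / s in (0, 1/2) with s <= n odd.
   Grouping all fractions by their gcd [d] gives
   sum_{d odd} |V_{n/d}| = n^2/8 + O(n), whereas sum_{d odd} 1/d^2 = pi^2/8.
   As pi^2/8 - 1 < 1, this relation forces |V_n| = n^2/pi^2 + o(n^2). *)

(* A curve of [X_n] must have all iterated derivatives near 0. The deformation is therefore given by
   explicit formulas in sines, cosines, quotients and square roots, inside a class of functions
   closed under differentiation; no implicit function theorem enters. The classification works up to
   rotation. The vertices where the polygon folds back are rotation invariant and determine the edge
   signs up to one common flip; as n is odd, exactly one of the two choices has positive sum. With j
   negative signs, s = n - 2j, and k takes m - j values. As 2(m - j) + 1 = n - 2j, the identity for
   |U_n| reduces to the telescoping sum of C(n, j)(n - 2j). Both occurrences of pi come from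
   elementary calculus: Wallis' bounds from explicit primitives of cos^n, and pi^2/8 from squeezing
   1/x^2 between cot^2 x and 1/sin^2 x at odd multiples of pi/2^(n+2), where the sum of 1/sin^2 is
   known exactly. The gcd relation is solved by a contraction of quadratic error bounds instead of
   Moebius inversion. *)
Require Import Defs.
From mathcomp Require Import all_boot all_order all_algebra finmap.
From mathcomp Require Import all_classical all_reals all_analysis.
From mathcomp Require Import ring lra zify.

Import Order.TTheory GRing.Theory Num.Theory.
Import numFieldNormedType.Exports.

Local Open Scope classical_set_scope.
Local Open Scope ring_scope.

(** * Germs of smooth functions *)

(* Closed under differentiation, so that its members are C^infinity for |t| < d. *)
Inductive smooth_on {R : realType} (d : R) : (R -> R) -> Prop :=
| smooth_on_cst c : smooth_on d (fun=> c)
| smooth_on_id : smooth_on d (fun t => t)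
| smooth_on_sin : smooth_on d (fun t => sin t)
| smooth_on_cos : smooth_on d (fun t => cos t)
| smooth_on_add f g : smooth_on d f -> smooth_on d g ->
    smooth_on d (fun t => f t + g t)
| smooth_on_mul f g : smooth_on d f -> smooth_on d g ->
    smooth_on d (fun t => f t * g t)
| smooth_on_inv f : smooth_on d f -> (forall t, `|t| < d -> f t != 0) ->
    smooth_on d (fun t => (f t)^-1)
| smooth_on_sqrt f : smooth_on d f -> (forall t, `|t| < d -> 0 < f t) ->
    smooth_on d (fun t => Num.sqrt (f t)).

Lemma smooth_on_derive {R : realType} (d : R) f : smooth_on d f ->
  exists2 g, smooth_on d g & forall t : R, `|t| < d -> is_derive t 1 f (g t).
Proof.
elim=> [c||||f1 f2 s1 [g1 t1 h1] s2 [g2 t2 h2]|f1 f2 s1 [g1 t1 h1] s2 [g2 t2 h2]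
  |f1 s1 [g1 t1 h1] n1|f1 s1 [g1 t1 h1] n1].
- exists (fun=> 0); first exact: smooth_on_cst.
  by move=> t _; exact: is_derive_cst.
- exists (fun=> 1); first exact: smooth_on_cst.
  by move=> t _; exact: is_derive_id.
- exists (fun t => cos t); first exact: smooth_on_cos.
  by move=> t _; exact: is_derive_sin.
- exists (fun t => -1 * sin t).
    by apply: smooth_on_mul; [exact: smooth_on_cst | exact: smooth_on_sin].
  by move=> t _; rewrite mulN1r; exact: is_derive_cos.
- exists (fun t => g1 t + g2 t); first exact: smooth_on_add.
  by move=> t td; apply: is_deriveD; [exact: h1 | exact: h2].
- exists (fun t => f1 t * g2 t + f2 t * g1 t).
    by apply: smooth_on_add; exact: smooth_on_mul.
  by move=> t td; apply: is_deriveM; [exact: h1 | exact: h2].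
- exists (fun t => -1 * ((f1 t)^-1 * (f1 t)^-1 * g1 t)).
    apply: smooth_on_mul; first exact: smooth_on_cst.
    by apply: smooth_on_mul => //; apply: smooth_on_mul; exact: smooth_on_inv.
  move=> t td; have [dr der] := h1 t td.
  apply: is_derive_eq; first exact: is_deriveV (n1 t td) _.
  by rewrite der mulN1r scaleNr /= -exprVn expr2.
- exists (fun t => (2 * Num.sqrt (f1 t))^-1 * g1 t).
    apply: smooth_on_mul => //; apply: smooth_on_inv.
      by apply: smooth_on_mul; [exact: smooth_on_cst | exact: smooth_on_sqrt].
    by move=> t td; rewrite mulf_neq0// gt_eqF// sqrtr_gt0 n1.
  move=> t td; have h := h1 t td.
  have h' := is_derive1_sqrt (n1 t td).
  by apply: (is_derive1_comp (f := @Num.sqrt R) (g := f1)); exact: h'.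
Qed.

Lemma near0_ball {R : realType} (d : R) (P : R -> Prop) :
  (forall t, `|t| < d -> P t) -> forall t : R, `|t| < d -> \forall s \near t, P s.
Proof.
move=> H t td; apply/nbhs_ballP; exists (d - `|t|); first by rewrite /= subr_gt0.
move=> s; rewrite /ball /= distrC => h; apply: H.
by have := ler_normD (s - t) t; rewrite subrK; lra.
Qed.

(** Nothing is known outside the ball, so only agreement on it is carried along; the ball being
    open, this already fixes the next derivative there. *)
Lemma smooth_on_derive1n {R : realType} (d : R) f (k : nat) : 0 < d ->
  smooth_on d f ->
  exists2 g, smooth_on d g & forall t, `|t| < d -> derive1n k f t = g t.
Proof.
move=> d0 sf; elim: k => [|k [g sg hg]]; first by exists f.
have [g' sg' hg'] := smooth_on_derive _ _ sg.
exists g' => // t td; rewrite derive1nS derive1E.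
have [_ <-] := hg' t td.
apply: near_eq_derive.
exact: near0_ball d _ hg t td.
Qed.

Lemma smooth_on_derivable {R : realType} (d : R) f (t : R) (k : nat) : 0 < d ->
  smooth_on d f -> `|t| < d -> derivable (derive1n k f) t 1.
Proof.
move=> d0 sf td; have [g sg hg] := smooth_on_derive1n d f k d0 sf.
have [g' _ /(_ t td)[dg _]] := smooth_on_derive _ _ sg.
apply: near_eq_derivable dg.
by apply: (near0_ball d) td => s sd; rewrite hg.
Qed.

Lemma smooth_on_continuous {R : realType} (d : R) f (t : R) :
  smooth_on d f -> `|t| < d -> {for t, continuous f}.
Proof.
move=> sf td; have [g _ /(_ t td)[dg _]] := smooth_on_derive _ _ sf.
exact/differentiable_continuous/derivable1_diffP.
Qed.

Lemma smooth_on_le {R : realType} (d e : R) f : e <= d -> smooth_on d f ->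
  smooth_on e f.
Proof.
move=> ed; elim=> [c||||g h _ sg _ sh|g h _ sg _ sh|g _ sg h|g _ sg h].
- exact: smooth_on_cst.
- exact: smooth_on_id.
- exact: smooth_on_sin.
- exact: smooth_on_cos.
- exact: smooth_on_add.
- exact: smooth_on_mul.
- by apply: smooth_on_inv => // t te; apply: h; exact: lt_le_trans te ed.
- by apply: smooth_on_sqrt => // t te; apply: h; exact: lt_le_trans te ed.
Qed.

(** The radius is existential so that it may shrink: inverses and square roots then only need a
    condition at 0, by continuity. *)
Definition smooth_germ {R : realType} (f : R -> R) : Prop :=
  exists2 d : R, 0 < d & smooth_on d f.

Lemma smooth_germ_cst {R : realType} (c : R) : smooth_germ (fun=> c).
Proof. by exists 1 => //; exact: smooth_on_cst. Qed.

Lemma smooth_germ_id {R : realType} : smooth_germ (fun t : R => t).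
Proof. by exists 1 => //; exact: smooth_on_id. Qed.

Lemma smooth_germ_add {R : realType} (f g : R -> R) :
  smooth_germ f -> smooth_germ g -> smooth_germ (fun t => f t + g t).
Proof.
move=> [d d0 sf] [e e0 sg]; exists (Num.min d e); first by rewrite lt_min d0.
by apply: smooth_on_add; [apply: smooth_on_le sf|apply: smooth_on_le sg];
  rewrite ge_min lexx ?orbT.
Qed.

Lemma smooth_germ_mul {R : realType} (f g : R -> R) :
  smooth_germ f -> smooth_germ g -> smooth_germ (fun t => f t * g t).
Proof.
move=> [d d0 sf] [e e0 sg]; exists (Num.min d e); first by rewrite lt_min d0.
by apply: smooth_on_mul; [apply: smooth_on_le sf|apply: smooth_on_le sg];
  rewrite ge_min lexx ?orbT.
Qed.

Lemma smooth_germ_opp {R : realType} (f : R -> R) :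
  smooth_germ f -> smooth_germ (fun t => - f t).
Proof.
move=> sf; have -> : (fun t => - f t) = (fun t => -1 * f t).
  by apply/funext => t; rewrite mulN1r.
by apply: smooth_germ_mul sf; exact: smooth_germ_cst.
Qed.

Lemma smooth_germ_near {R : realType} (f : R -> R) (P : set R) :
  smooth_germ f -> nbhs (f 0) P -> \forall t \near (0 : R), P (f t).
Proof.
move=> [d d0 sf] nP; apply: (smooth_on_continuous d f 0 sf) => //.
by rewrite normr0.
Qed.

Lemma near0_norm {R : realType} (P : R -> Prop) :
  (\forall t \near (0 : R), P t) ->
  exists2 d : R, 0 < d & forall t, `|t| < d -> P t.
Proof.
move=> /nbhs_ballP[d d0 h]; exists d => // t td; apply: h.
by rewrite /ball /= sub0r normrN.
Qed.

Lemma norm_near0 {R : realType} (P : R -> Prop) (d : R) : 0 < d ->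
  (forall t, `|t| < d -> P t) -> \forall t \near (0 : R), P t.
Proof.
by move=> d0 h; apply: (near0_ball d _ h); rewrite normr0.
Qed.

Lemma smooth_germ_neq0 {R : realType} (f : R -> R) :
  smooth_germ f -> f 0 != 0 -> \forall t \near (0 : R), f t != 0.
Proof.
move=> sf f0; apply: (smooth_germ_near f [set x | x != 0] sf).
by apply: open_nbhs_nbhs; split => //; exact: open_neq.
Qed.

Lemma smooth_germ_gt0 {R : realType} (f : R -> R) :
  smooth_germ f -> 0 < f 0 -> \forall t \near (0 : R), 0 < f t.
Proof.
move=> sf f0; apply: (smooth_germ_near f [set x | 0 < x] sf).
by apply: open_nbhs_nbhs; split => //; exact: open_gt.
Qed.

Lemma smooth_germ_inv {R : realType} (f : R -> R) :
  smooth_germ f -> f 0 != 0 -> smooth_germ (fun t => (f t)^-1).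
Proof.
move=> sf f0; have [e e0 he] := near0_norm _ (smooth_germ_neq0 f sf f0).
have [d d0 sfd] := sf.
exists (Num.min d e); first by rewrite lt_min d0.
apply: smooth_on_inv; first by apply: smooth_on_le sfd; rewrite ge_min lexx.
by move=> t; rewrite lt_min => /andP[_ /he].
Qed.

Lemma smooth_germ_sqrt {R : realType} (f : R -> R) :
  smooth_germ f -> 0 < f 0 -> smooth_germ (fun t => Num.sqrt (f t)).
Proof.
move=> sf f0; have [e e0 he] := near0_norm _ (smooth_germ_gt0 f sf f0).
have [d d0 sfd] := sf.
exists (Num.min d e); first by rewrite lt_min d0.
apply: smooth_on_sqrt; first by apply: smooth_on_le sfd; rewrite ge_min lexx.
by move=> t; rewrite lt_min => /andP[_ /he].
Qed.

(** [smooth_on] has no composition rule, so the shift is removed by the addition formula. *)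
Lemma smooth_germ_cosD {R : realType} (a : R) :
  smooth_germ (fun t => cos (a + t)).
Proof.
have -> : (fun t => cos (a + t)) =
          (fun t => cos a * cos t + - (sin a * sin t)).
  by apply/funext => t; rewrite cosD.
apply: smooth_germ_add; last apply: smooth_germ_opp.
all: apply: smooth_germ_mul; first exact: smooth_germ_cst.
all: by exists 1; [|exact: smooth_on_cos || exact: smooth_on_sin].
Qed.

Lemma smooth_germ_sinD {R : realType} (a : R) :
  smooth_germ (fun t => sin (a + t)).
Proof.
have -> : (fun t => sin (a + t)) =
          (fun t => sin a * cos t + cos a * sin t).
  by apply/funext => t; rewrite sinD.
apply: smooth_germ_add.
all: apply: smooth_germ_mul; first exact: smooth_germ_cst.
all: by exists 1; [|exact: smooth_on_cos || exact: smooth_on_sin].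
Qed.

Lemma smooth_germ_derivable {R : realType} (f : R -> R) :
  smooth_germ f ->
  \forall t \near (0 : R), forall k, derivable (derive1n k f) t 1.
Proof.
move=> [d d0 sf]; apply: (norm_near0 _ d d0) => t td k.
exact: smooth_on_derivable d0 sf td.
Qed.

Lemma smooth_germ_near0 {R : realType} {n : nat} (g : R -> config R n) :
  (forall i j, smooth_germ (fun s => (g s).1 i j 0)) ->
  smooth_germ (fun s => (g s).2) -> smooth_near0 g.
Proof.
move=> s1 s2; have h1 : \forall t \near (0 : R), forall i j k,
    derivable (derive1n k (fun s => (g s).1 i j 0)) t 1.
  apply: (@filter_forall _ _ (fun i t => forall j k,
    derivable (derive1n k (fun s => (g s).1 i j 0)) t 1)
    (nbhs (0 : R)) _) => i.
  apply: (@filter_forall _ _ (fun j t => forall k,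
    derivable (derive1n k (fun s => (g s).1 i j 0)) t 1)
    (nbhs (0 : R)) _) => j.
  exact: smooth_germ_derivable.
have h2 := smooth_germ_derivable _ s2.
by apply: filterS2 h1 h2 => t H1 H2 k; split=> [i j|]; [exact: H1 | exact: H2].
Qed.

(** * Deformation of a polygon with a bent vertex *)

Lemma dotC {R : realType} (u v : 'cV[R]_3) : dot u v = dot v u.
Proof. by apply: eq_bigr => i _; rewrite mulrC. Qed.

Lemma dotDl {R : realType} (u v w : 'cV[R]_3) : dot (u + v) w = dot u w + dot v w.
Proof. by rewrite -big_split; apply: eq_bigr => i _; rewrite mxE mulrDl. Qed.

Lemma dotZl {R : realType} (c : R) (u v : 'cV[R]_3) : dot (c *: u) v = c * dot u v.
Proof. by rewrite /dot mulr_sumr; apply: eq_bigr => i _; rewrite mxE mulrA. Qed.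

Lemma dotNl {R : realType} (u v : 'cV[R]_3) : dot (- u) v = - dot u v.
Proof. by rewrite -scaleN1r dotZl mulN1r. Qed.

Lemma dotDr {R : realType} (u v w : 'cV[R]_3) : dot w (u + v) = dot w u + dot w v.
Proof. by rewrite dotC dotDl !(dotC w). Qed.

Lemma dotZr {R : realType} (c : R) (u v : 'cV[R]_3) : dot v (c *: u) = c * dot v u.
Proof. by rewrite dotC dotZl dotC. Qed.

Lemma dotNr {R : realType} (u v : 'cV[R]_3) : dot v (- u) = - dot v u.
Proof. by rewrite dotC dotNl dotC. Qed.

Definition dotE {R : realType} :=
  (@dotDl R, @dotDr R, @dotZl R, @dotZr R, @dotNl R, @dotNr R).

Lemma dot_ge0 {R : realType} (u : 'cV[R]_3) : 0 <= dot u u.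
Proof. by apply: sumr_ge0 => i _; rewrite -expr2 sqr_ge0. Qed.

Lemma dot_eq0 {R : realType} (u : 'cV[R]_3) : dot u u = 0 -> u = 0.
Proof.
move=> /eqP; rewrite psumr_eq0 => [/allP h|i _]; last by rewrite -expr2 sqr_ge0.
apply/matrixP => i j; rewrite mxE ord1; apply/eqP.
by have := h i (mem_index_enum _); rewrite /= mulf_eq0 orbb.
Qed.

(** Cauchy-Schwarz: [1 - dot u v ^+ 2] is the squared length of the part of [v] orthogonal to
    [u]. *)
Lemma dot_sqr_le1 {R : realType} (u v : 'cV[R]_3) :
  dot u u = 1 -> dot v v = 1 -> dot u v ^+ 2 <= 1.
Proof.
move=> u1 v1; have := dot_ge0 (v + - (dot u v *: u)).
rewrite !dotE u1 v1 (dotC v u); nra.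
Qed.

Lemma dot_unit_itv {R : realType} (u v : 'cV[R]_3) :
  dot u u = 1 -> dot v v = 1 -> -1 <= dot u v <= 1.
Proof. by move=> u1 v1; have := dot_sqr_le1 u v u1 v1; nra. Qed.

Lemma dot_unit_eq1 {R : realType} (u v : 'cV[R]_3) :
  dot u u = 1 -> dot v v = 1 -> dot u v = 1 -> u = v.
Proof.
move=> u1 v1 uv; apply/eqP; rewrite -subr_eq0; apply/eqP/dot_eq0.
by rewrite !dotE u1 v1 (dotC v) uv; ring.
Qed.

Lemma dot_unit_eqN1 {R : realType} (u v : 'cV[R]_3) :
  dot u u = 1 -> dot v v = 1 -> dot u v = -1 -> u = - v.
Proof. by move=> u1 v1 uv; apply: dot_unit_eq1; rewrite // !dotE ?v1 ?uv opprK. Qed.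

(** Trades the arccosine for constraints that are polynomial in the coordinates and can be
    differentiated. *)
Lemma BnP {R : realType} {n : nat} (p : config R n) : Bn R n p <->
  [/\ forall i, dot (p.1 i) (p.1 i) = 1, 0 < p.2 < pi &
      forall i, dot (p.1 i) (p.1 (ordS i)) = cos p.2].
Proof.
split=> -[s a d]; split=> // i.
  by rewrite -(d i) acosK // in_itv /=; by apply: dot_unit_itv; exact: s.
rewrite /sdist d cosK // in_itv /=.
by move: a => /andP[a0 api]; rewrite !ltW.
Qed.

Definition smooth_vec {R : realType} (v : R -> 'cV[R]_3) : Prop :=
  forall j, smooth_germ (fun t => v t j 0).

Lemma smooth_vec_cst {R : realType} (v : 'cV[R]_3) : smooth_vec (fun=> v).
Proof. by move=> j; exact: smooth_germ_cst. Qed.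

Lemma smooth_vec_add {R : realType} (v w : R -> 'cV[R]_3) :
  smooth_vec v -> smooth_vec w -> smooth_vec (fun t => v t + w t).
Proof.
move=> sv sw j.
have -> : (fun t => (v t + w t) j 0) = (fun t => v t j 0 + w t j 0).
  by apply/funext => t; rewrite mxE.
exact: smooth_germ_add.
Qed.

Lemma smooth_vec_scale {R : realType} (f : R -> R) (v : R -> 'cV[R]_3) :
  smooth_germ f -> smooth_vec v -> smooth_vec (fun t => f t *: v t).
Proof.
move=> sf sv j.
have -> : (fun t => (f t *: v t) j 0) = (fun t => f t * v t j 0).
  by apply/funext => t; rewrite mxE.
exact: smooth_germ_mul.
Qed.

Lemma smooth_vec_opp {R : realType} (v : R -> 'cV[R]_3) :
  smooth_vec v -> smooth_vec (fun t => - v t).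
Proof.
move=> sv j.
have -> : (fun t => (- v t) j 0) = (fun t => - v t j 0).
  by apply/funext => t; rewrite mxE.
exact: smooth_germ_opp.
Qed.

Lemma smooth_germ_dot {R : realType} (v w : R -> 'cV[R]_3) :
  smooth_vec v -> smooth_vec w -> smooth_germ (fun t => dot (v t) (w t)).
Proof.
move=> sv sw; have -> : (fun t => dot (v t) (w t)) =
    (fun t => v t 0 0 * w t 0 0 + (v t 1 0 * w t 1 0 + v t 2 0 * w t 2 0)).
  apply/funext => t; rewrite /dot !big_ord_recl big_ord0 addr0.
  by congr (_ * _ + (_ * _ + _ * _)); congr (_ _ _); exact/val_inj.
by do 2?apply: smooth_germ_add; exact: smooth_germ_mul.
Qed.

(* The neighbour of [v t] at distance [a + t] in the direction of [w]. *)
Definition chain_step {R : realType} (a : R) (w : 'cV[R]_3)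
    (v : R -> 'cV[R]_3) (t : R) : 'cV[R]_3 :=
  cos (a + t) *: v t +
  (sin (a + t) / Num.sqrt (1 - dot w (v t) ^+ 2)) *: (w - dot w (v t) *: v t).

Section chain_step.
Context {R : realType} (a : R) (w : 'cV[R]_3) (v : R -> 'cV[R]_3).
Hypotheses (a0pi : 0 < a < pi) (sv : smooth_vec v) (w1 : dot w w = 1)
  (wv : dot w (v 0) = cos a).

Let defect t := 1 - dot w (v t) ^+ 2.

Let defect0 : defect 0 = sin a ^+ 2.
Proof. by rewrite /defect wv sin2cos2. Qed.

Let defect_gt0 : 0 < defect 0.
Proof. by rewrite defect0 exprn_gt0// sin_gt0_pi. Qed.

Let sdot : smooth_germ (fun t => dot w (v t)).
Proof. by apply: smooth_germ_dot => //; exact: smooth_vec_cst. Qed.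

Let sdefect : smooth_germ defect.
Proof.
apply: smooth_germ_add; first exact: smooth_germ_cst.
by apply: smooth_germ_opp; apply: smooth_germ_mul.
Qed.

Lemma smooth_chain_step : smooth_vec (chain_step a w v).
Proof.
apply: smooth_vec_add.
  by apply: smooth_vec_scale => //; exact: smooth_germ_cosD.
apply: smooth_vec_scale.
  apply: smooth_germ_mul; first exact: smooth_germ_sinD.
  apply: smooth_germ_inv; first exact: smooth_germ_sqrt.
  by rewrite gt_eqF// sqrtr_gt0.
apply: smooth_vec_add; first exact: smooth_vec_cst.
by apply: smooth_vec_opp; exact: smooth_vec_scale.
Qed.

(** At [t = 0] the square root is [sin a], so the orthogonal part of [w] gets coefficient 1 and the
    two summands recombine to [w]. *)
Lemma chain_step0 : chain_step a w v 0 = w.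
Proof.
rewrite /chain_step -/(defect 0) defect0 sqrtr_sqr addr0.
have s0 : 0 < sin a by exact: sin_gt0_pi.
by rewrite gtr0_norm// divff ?gt_eqF// scale1r wv addrC subrK.
Qed.

Lemma chain_step_near :
  (\forall t \near (0 : R), dot (v t) (v t) = 1) ->
  \forall t \near (0 : R),
    dot (chain_step a w v t) (chain_step a w v t) = 1 /\
    dot (v t) (chain_step a w v t) = cos (a + t).
Proof.
move=> v1; have d0 := smooth_germ_gt0 _ sdefect defect_gt0.
apply: filterS2 v1 d0 => t v1 d0.
rewrite /chain_step -/(defect t) !dotE (dotC _ w) v1 w1; split; last by ring.
have : Num.sqrt (defect t) ^+ 2 = defect t by rewrite sqr_sqrtr// ltW.
have : Num.sqrt (defect t) != 0 by rewrite gt_eqF// sqrtr_gt0.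
move: (Num.sqrt _) => s s0; rewrite /defect => s2.
have := cos2Dsin2 (a + t); move: (cos _) (sin _) => c r cr.
transitivity (c ^+ 2 + r ^+ 2 * ((1 - dot w (v t) ^+ 2) / s ^+ 2)); first by field.
by rewrite -s2 divff ?expf_neq0// mulr1.
Qed.

End chain_step.

(** The first vertex stays fixed; each later one is aimed at its original position [u k], so that
    the chain passes through [u] at [t = 0]. *)
Fixpoint chain {R : realType} (a : R) (u : nat -> 'cV[R]_3) (k : nat) :
    R -> 'cV[R]_3 :=
  if k is k'.+1 then chain_step a (u k) (chain a u k') else fun=> u 0.

Lemma chainP {R : realType} (a : R) (u : nat -> 'cV[R]_3) (k : nat) :
  0 < a < pi -> (forall i, dot (u i) (u i) = 1) ->
  (forall i, dot (u i) (u i.+1) = cos a) ->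
  [/\ smooth_vec (chain a u k), chain a u k 0 = u k &
      \forall t \near (0 : R), dot (chain a u k t) (chain a u k t) = 1].
Proof.
move=> a0 u1 ua; elim: k => [|k [sk k0 k1]].
  by split; [exact: smooth_vec_cst| |near=> t; exact: u1].
have wv : dot (u k.+1) (chain a u k 0) = cos a by rewrite k0 dotC.
split=> /=; first exact: smooth_chain_step.
  exact: chain_step0.
by apply: filterS (chain_step_near a (u k.+1) _ a0 sk (u1 _) wv k1) => t [].
Unshelve. all: by end_near. Qed.

Lemma chain_dot {R : realType} (a : R) (u : nat -> 'cV[R]_3) (k : nat) :
  0 < a < pi -> (forall i, dot (u i) (u i) = 1) ->
  (forall i, dot (u i) (u i.+1) = cos a) ->
  \forall t \near (0 : R), dot (chain a u k t) (chain a u k.+1 t) = cos (a + t).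
Proof.
move=> a0 u1 ua; have [sk k0 k1] := chainP a u k a0 u1 ua.
have wv : dot (u k.+1) (chain a u k 0) = cos a by rewrite k0 dotC.
by apply: filterS (chain_step_near a (u k.+1) _ a0 sk (u1 _) wv k1) => t [].
Qed.

(* For unit [p] and [q], the component of [u] orthogonal to their plane. *)
Definition normal_part {R : realType} (u p q : 'cV[R]_3) : 'cV[R]_3 :=
  u - (1 - dot p q ^+ 2)^-1 *:
        ((dot u p - dot p q * dot u q) *: p + (dot u q - dot p q * dot u p) *: q).

Lemma normal_part_orth {R : realType} (u p q : 'cV[R]_3) :
  dot p p = 1 -> dot q q = 1 -> 1 - dot p q ^+ 2 != 0 ->
  dot (normal_part u p q) p = 0 /\ dot (normal_part u p q) q = 0.
Proof.
by move=> p1 q1 D; rewrite /normal_part !dotE (dotC q p) p1 q1; split; field.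
Qed.

(* A point at distance [a] from both [p] and [q]; the square root rescales the
   normal component so that the point lies on the sphere. *)
Definition apex {R : realType} (a : R) (u p q : 'cV[R]_3) : 'cV[R]_3 :=
  (cos a / (1 + dot p q)) *: (p + q) +
  Num.sqrt ((1 - 2 * cos a ^+ 2 / (1 + dot p q)) /
            dot (normal_part u p q) (normal_part u p q)) *: normal_part u p q.

(** [p + q] has inner product [1 + dot p q] with both points, so the first summand alone gives the
    right distances. Its squared length is [2 * cos a ^+ 2 / (1 + dot p q)], and the orthogonal
    summand supplies the rest. *)
Lemma apexP {R : realType} (a : R) (u p q : 'cV[R]_3) :
  dot p p = 1 -> dot q q = 1 -> 1 + dot p q != 0 -> 1 - dot p q ^+ 2 != 0 ->
  0 < dot (normal_part u p q) (normal_part u p q) ->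
  0 < 1 - 2 * cos a ^+ 2 / (1 + dot p q) ->
  [/\ dot (apex a u p q) (apex a u p q) = 1,
      dot (apex a u p q) p = cos a & dot (apex a u p q) q = cos a].
Proof.
move=> p1 q1 D1 D2; have [np nq] := normal_part_orth u p q p1 q1 D2.
rewrite /apex; move: (normal_part u p q) np nq => e ep eq e0 r0.
set s := Num.sqrt _.
have s2 : s ^+ 2 = (1 - 2 * cos a ^+ 2 / (1 + dot p q)) / dot e e.
  by rewrite sqr_sqrtr// divr_ge0// ltW.
rewrite !dotE (dotC q p) (dotC p e) (dotC q e) ep eq p1 q1; split.
- transitivity (s ^+ 2 * dot e e + 2 * cos a ^+ 2 / (1 + dot p q)).
    by field.
  by rewrite s2 divfK ?subrK// gt_eqF.
- by field.
- by field.
Qed.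

Section apex0.
Context {R : realType} (a : R) (u p q : 'cV[R]_3).
Hypotheses (u1 : dot u u = 1) (p1 : dot p p = 1) (q1 : dot q q = 1)
  (up : dot u p = cos a) (uq : dot u q = cos a)
  (pq : p != q) (upq : p + q != (2 * cos a) *: u).

(** If [p = - q], then [cos a = - cos a = 0], and both sides of [upq] vanish. *)
Lemma apex_D1 : 1 + dot p q != 0.
Proof.
apply/eqP => h; have pqN : p = - q.
  by apply: dot_unit_eqN1 => //; lra.
move: upq; rewrite pqN addNr.
by have := up; rewrite pqN dotNr uq => h'; rewrite (_ : cos a = 0) ?mulr0 ?scale0r ?eqxx//; lra.
Qed.

Lemma apex_D2 : 1 - dot p q ^+ 2 != 0.
Proof.
rewrite (_ : 1 - _ = (1 - dot p q) * (1 + dot p q)); last by ring.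
rewrite mulf_neq0 ?apex_D1// subr_eq0 eq_sym.
by apply: contra pq => /eqP h; apply/eqP/dot_unit_eq1.
Qed.

Lemma normal_partE :
  normal_part u p q = u - (cos a / (1 + dot p q)) *: (p + q).
Proof.
rewrite /normal_part up uq -scalerDr scalerA; congr (_ - _ *: _).
have := apex_D1; have := apex_D2 => D1 D2; field.
by rewrite D1 D2.
Qed.

Lemma dot_normal_part : dot (normal_part u p q) (normal_part u p q) =
  1 - 2 * cos a ^+ 2 / (1 + dot p q).
Proof.
rewrite normal_partE !dotE (dotC q p) (dotC p u) (dotC q u) u1 p1 q1 up uq.
by field; exact: apex_D1.
Qed.

(** Bentness enters here: without normal part, [u] is a multiple of [p + q], and its unit length
    forces [p + q = 2 cos(a) u]. *)
Lemma normal_part_gt0 : 0 < dot (normal_part u p q) (normal_part u p q).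
Proof.
rewrite lt_def dot_ge0 andbT; apply/eqP => h0; have h := dot_eq0 _ h0.
have := h0; rewrite dot_normal_part => h2.
move: upq; rewrite normal_partE in h.
have -> : u = (cos a / (1 + dot p q)) *: (p + q) by apply/eqP; rewrite -subr_eq0 h.
rewrite scalerA (_ : _ * _ = 1) ?scale1r ?eqxx//.
transitivity (2 * cos a ^+ 2 / (1 + dot p q)); [by ring|lra].
Qed.

Lemma apex0 : apex a u p q = u.
Proof.
rewrite /apex -dot_normal_part divff ?gt_eqF ?normal_part_gt0// sqrtr1 scale1r.
by rewrite normal_partE addrC subrK.
Qed.

End apex0.

Lemma smooth_apex {R : realType} (a : R) (u : 'cV[R]_3) (p q : R -> 'cV[R]_3) :
  smooth_vec p -> smooth_vec q -> dot u u = 1 ->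
  (\forall t \near (0 : R), dot (p t) (p t) = 1) ->
  (\forall t \near (0 : R), dot (q t) (q t) = 1) ->
  dot u (p 0) = cos a -> dot u (q 0) = cos a ->
  p 0 != q 0 -> p 0 + q 0 != (2 * cos a) *: u ->
  smooth_vec (fun t => apex (a + t) u (p t) (q t)) /\
  \forall t \near (0 : R),
    [/\ dot (apex (a + t) u (p t) (q t)) (apex (a + t) u (p t) (q t)) = 1,
        dot (apex (a + t) u (p t) (q t)) (p t) = cos (a + t) &
        dot (apex (a + t) u (p t) (q t)) (q t) = cos (a + t)].
Proof.
move=> sp sq u1 pn qn up uq pq upq.
have p1 := nbhs_singleton pn; have q1 := nbhs_singleton qn.
rewrite /= in p1 q1.
have D1 := apex_D1 a u _ _ p1 q1 up uq upq.
have D2 := apex_D2 a u _ _ p1 q1 up uq pq upq.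
have e0 := normal_part_gt0 a u _ _ u1 p1 q1 up uq pq upq.
have r0 := e0; rewrite (dot_normal_part a)// in r0.
have sup : smooth_germ (fun t => dot u (p t)).
  by apply: smooth_germ_dot => //; exact: smooth_vec_cst.
have suq : smooth_germ (fun t => dot u (q t)).
  by apply: smooth_germ_dot => //; exact: smooth_vec_cst.
have spq := smooth_germ_dot _ _ sp sq.
have sD1 : smooth_germ (fun t => 1 + dot (p t) (q t)).
  by apply: smooth_germ_add => //; exact: smooth_germ_cst.
have sD2 : smooth_germ (fun t => 1 - dot (p t) (q t) ^+ 2).
  apply: smooth_germ_add; first exact: smooth_germ_cst.
  by apply: smooth_germ_opp; exact: smooth_germ_mul.
have se : smooth_vec (fun t => normal_part u (p t) (q t)).
  apply: smooth_vec_add; first exact: smooth_vec_cst.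
  apply: smooth_vec_opp; apply: smooth_vec_scale; first exact: smooth_germ_inv.
  by apply: smooth_vec_add; apply: smooth_vec_scale => //;
    apply: smooth_germ_add => //; apply: smooth_germ_opp; exact: smooth_germ_mul.
have see := smooth_germ_dot _ _ se se.
have sc := smooth_germ_cosD a.
have sr : smooth_germ (fun t => 1 - 2 * cos (a + t) ^+ 2 / (1 + dot (p t) (q t))).
  apply: smooth_germ_add; first exact: smooth_germ_cst.
  apply: smooth_germ_opp; apply: smooth_germ_mul; last exact: smooth_germ_inv.
  by apply: smooth_germ_mul; [exact: smooth_germ_cst|exact: smooth_germ_mul].
have r0' : 0 < 1 - 2 * cos (a + 0) ^+ 2 / (1 + dot (p 0) (q 0)) by rewrite addr0.
split.
  apply: smooth_vec_add; apply: smooth_vec_scale => //.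
  - by apply: smooth_germ_mul => //; exact: smooth_germ_inv.
  - exact: smooth_vec_add.
  - apply: smooth_germ_sqrt; last by rewrite divr_gt0.
    by apply: smooth_germ_mul => //; apply: smooth_germ_inv => //; rewrite gt_eqF.
have nD1 := smooth_germ_neq0 _ sD1 D1.
have nD2 := smooth_germ_neq0 _ sD2 D2.
have ne := smooth_germ_gt0 _ see e0.
have nr := smooth_germ_gt0 _ sr r0'.
near=> t; apply: apexP; by near: t.
Unshelve. all: by end_near. Qed.

(** * Orbits, cyclic order of the vertices, and the bending curve *)

Lemma SO3_1 {R : realType} : SO3 R 1%:M.
Proof. by split; [rewrite trmx1 mulmx1 | rewrite det1]. Qed.

Lemma rotate1 {R : realType} {n : nat} (p : config R n) : rotate 1%:M p = p.
Proof.
by case: p => u a; rewrite /rotate /=; congr (_, _); apply/funext => i; rewrite mul1mx.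
Qed.

Lemma orbit_refl {R : realType} {n : nat} (p : config R n) : orbitSO3 p p.
Proof. by exists 1%:M; [exact: SO3_1 | exact: rotate1]. Qed.

Lemma mu_orbit {R : realType} {n : nat} (p : config R n) : mu (orbitSO3 p) = p.2.
Proof.
rewrite /mu; set A := [set _ | _ in _].
have /getI [q [B _ <-] <-] // : A p.2 by exists p => //; exact: orbit_refl.
Qed.

Lemma val_iter_ordS {n : nat} (i : 'I_n) k : (iter k (@ordS n) i : nat) = ((i + k) %% n)%N.
Proof.
elim: k => [|k IH]; first by rewrite addn0 modn_small.
by rewrite iterS /= IH -addn1 modnDml addn1 addnS.
Qed.

Section cyclic_index.
Context {n : nat} (i0 : 'I_n).

(** Number of cyclic steps from [i0] to [j]; adding [n - i0] avoids a truncated subtraction. *)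
Definition cyc_index (j : 'I_n) : nat := ((j + (n - i0)) %% n)%N.

Lemma cyc_index_lt j : (cyc_index j < n)%N.
Proof. by rewrite ltn_mod (leq_ltn_trans _ (ltn_ord i0)). Qed.

Lemma iter_cyc_index j : iter (cyc_index j) (@ordS n) i0 = j.
Proof.
apply/val_inj; rewrite /= val_iter_ordS modnDmr addnCA subnKC; last exact: ltnW.
by rewrite modnDr modn_small.
Qed.

Lemma cyc_indexS j : cyc_index (ordS j) = ((cyc_index j).+1 %% n)%N.
Proof. by rewrite /cyc_index /= modnDml -[in RHS]addn1 modnDml addn1 addSn. Qed.

End cyclic_index.

Lemma bend_curve {R : realType} {n : nat} (p : config R n) (i : 'I_n) :
  (2 < n)%N -> Bn R n p -> p.1 (ordS (ordS i)) != p.1 i ->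
  p.1 (ordS (ordS i)) + p.1 i != (2 * cos p.2) *: p.1 (ordS i) ->
  exists g : R -> config R n,
    [/\ smooth_near0 g, \forall t \near (0 : R), Bn R n (g t), g 0 = p &
        forall t, (g t).2 = p.2 + t].
Proof.
move=> n2 /BnP[u1 a0 ua] pq upq.
set a := p.2; set i0 := ordS i.
(* The open chain starts just after the bent vertex [i0] and reaches its other neighbour [i] after
   [n - 2] steps. *)
pose U k := p.1 (iter k (@ordS n) (ordS i0)).
have U1 k : dot (U k) (U k) = 1 by exact: u1.
have Ua k : dot (U k) (U k.+1) = cos a by exact: ua.
have Uend : U (n - 2)%N = p.1 i.
  rewrite /U -iterSr -iterSr; congr (p.1 _); apply: ord_inj.
  rewrite val_iter_ordS (_ : (n - 2).+2 = n); last by lia.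
  by rewrite modnDr modn_small.
have [sp p0 p1] := chainP a U 0 a0 U1 Ua.
have [sq q0 q1] := chainP a U (n - 2)%N a0 U1 Ua.
have := smooth_apex a (p.1 i0) _ _ sp sq (u1 i0) p1 q1; rewrite p0 q0 Uend.
have ui : dot (p.1 i0) (p.1 i) = cos a by rewrite dotC; exact: ua.
move=> /(_ (ua i0) ui pq upq) [sv hv].
(* Positions count from the bent vertex: 0 is the apex, and [k'.+1] is chain vertex [k']. *)
pose v k t := if k is k'.+1 then chain a U k' t
  else apex (a + t) (p.1 i0) (chain a U 0 t) (chain a U (n - 2)%N t).
have v1 k : \forall t \near (0 : R), dot (v k t) (v k t) = 1.
  case: k => [|k]; first by apply: filterS hv => t [].
  by have [] := chainP a U k a0 U1 Ua.
have va k : (k < n)%N ->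
    \forall t \near (0 : R), dot (v k t) (v (k.+1 %% n)%N t) = cos (a + t).
  move=> kn; case: k kn => [|k] kn.
    by rewrite modn_small; [apply: filterS hv => t []|lia].
  (* Either both ends of the edge lie on the chain, or [k.+1] is the last position and the edge
     returns to the apex. *)
  have [kn1|kn1] := ltnP k.+2 n.
    by rewrite modn_small//; exact: chain_dot.
  have -> : k.+2 = n by lia.
  rewrite modnn /v (_ : k = n - 2)%N; last by lia.
  by apply: filterS hv => t [_ _ h]; rewrite dotC.
pose g t : config R n := (fun j => v (cyc_index i0 j) t, a + t).
exists g; split=> //.
- apply: smooth_germ_near0 => /=.
    move=> j; rewrite /g /=; case: (cyc_index i0 j) => [|k] //=.
    by have [] := chainP a U k a0 U1 Ua.
  by apply: smooth_germ_add; [exact: smooth_germ_cst|exact: smooth_germ_id].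
- have h1 : \forall t \near (0 : R), forall j, dot ((g t).1 j) ((g t).1 j) = 1.
    apply: (@filter_forall _ _ (fun j t => dot ((g t).1 j) ((g t).1 j) = 1)
      (nbhs (0 : R)) _) => j; exact: v1.
  have h2 : \forall t \near (0 : R), forall j,
      dot ((g t).1 j) ((g t).1 (ordS j)) = cos (a + t).
    apply: (@filter_forall _ _ (fun j t =>
      dot ((g t).1 j) ((g t).1 (ordS j)) = cos (a + t)) (nbhs (0 : R)) _) => j.
    by rewrite /g /= cyc_indexS; apply: va; exact: cyc_index_lt.
  have sa : smooth_germ (fun t => a + t).
    by apply: smooth_germ_add; [exact: smooth_germ_cst|exact: smooth_germ_id].
  have spa : smooth_germ (fun t => pi - (a + t)).
    by apply: smooth_germ_add; [exact: smooth_germ_cst|exact: smooth_germ_opp].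
  have [al ar] := andP a0.
  have h3 : \forall t \near (0 : R), 0 < a + t.
    by apply: smooth_germ_gt0 sa _; rewrite addr0.
  have h4 : \forall t \near (0 : R), 0 < pi - (a + t).
    by apply: smooth_germ_gt0 spa _; rewrite addr0 subr_gt0.
  near=> t; apply/BnP; split; first by near: t.
    rewrite /g /=; apply/andP; split; first by near: t.
    by rewrite -subr_gt0; near: t.
  by rewrite /=; near: t.
- rewrite /g addr0 [RHS]surjective_pairing; congr (_, _); apply/funext => j.
  rewrite -[in RHS](iter_cyc_index i0 j); case: (cyc_index i0 j) => [|k] /=.
    by rewrite addr0 q0 Uend; apply: apex0.
  have [_ -> _] := chainP a U k a0 U1 Ua.
  by rewrite /U -iterS iterSr.
Unshelve. all: by end_near. Qed.

Definition on_great_circle {R : realType} {n : nat} (p : config R n) : Prop :=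
  forall i, p.1 (ordS (ordS i)) = p.1 i \/
    p.1 (ordS (ordS i)) + p.1 i = (2 * cos p.2) *: p.1 (ordS i).

Lemma critical_great_circle {R : realType} {n : nat} (p : config R n) :
  (2 < n)%N -> Bn R n p -> critical_point (orbitSO3 p) -> on_great_circle p.
Proof.
move=> n2 bp [_ crit] i.
have [e|e] := eqVneq (p.1 (ordS (ordS i))) (p.1 i); first by left.
have [e'|e'] := eqVneq (p.1 (ordS (ordS i)) + p.1 i)
  ((2 * cos p.2) *: p.1 (ordS i)); first by right.
have [g [sg bg g0 g2]] := bend_curve p i n2 bp e e'.
have muE : mu \o (fun t => orbitSO3 (g t)) = (fun t => p.2 + t).
  by apply/funext => t; rewrite /= mu_orbit g2.
have : is_derive (0 : R) 1 (mu \o (fun t => orbitSO3 (g t))) 0.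
  apply: crit; last by rewrite g0.
  by exists g; split => //; near=> t.
rewrite muE => h.
have h' : is_derive (0 : R) 1 (fun t : R => p.2 + t) (0 + 1).
  exact: is_deriveD.
have := @derive_val _ _ _ _ _ _ _ h; rewrite (@derive_val _ _ _ _ _ _ _ h').
by rewrite add0r => /eqP; rewrite oner_eq0.
Unshelve. all: by end_near.
Qed.

(** * Great-circle polygons are critical *)

Lemma SO3_mul {R : realType} (A B : 'M[R]_3) : SO3 R A -> SO3 R B -> SO3 R (A *m B).
Proof.
move=> [A1 dA] [B1 dB]; split; last by rewrite det_mulmx dA dB mulr1.
by rewrite trmx_mul mulmxA -(mulmxA A) B1 mulmx1.
Qed.

Lemma SO3_tr {R : realType} (A : 'M[R]_3) : SO3 R A -> SO3 R A^T.
Proof. by move=> [A1 dA]; split; [rewrite trmxK; exact: mulmx1C | rewrite det_tr]. Qed.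

Lemma rotateM {R : realType} {n : nat} (A B : 'M[R]_3) (p : config R n) :
  rotate A (rotate B p) = rotate (A *m B) p.
Proof. by rewrite /rotate /=; congr (_, _); apply/funext => i; rewrite mulmxA. Qed.

Lemma orbit_rotate {R : realType} {n : nat} (A : 'M[R]_3) (p : config R n) :
  SO3 R A -> orbitSO3 (rotate A p) = orbitSO3 p.
Proof.
move=> sA; apply/seteqP; split=> q [B sB <-].
  by rewrite rotateM; exists (B *m A) => //; exact: SO3_mul.
exists (B *m A^T); first by apply: SO3_mul => //; exact: SO3_tr.
by rewrite rotateM -mulmxA (mulmx1C sA.1) mulmx1.
Qed.

Lemma dotE_mx {R : realType} (u v : 'cV[R]_3) : dot u v = (u^T *m v) 0 0.
Proof. by rewrite mxE; apply: eq_bigr => i _; rewrite mxE. Qed.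

Lemma dot_SO3 {R : realType} (A : 'M[R]_3) (u v : 'cV[R]_3) :
  SO3 R A -> dot (A *m u) (A *m v) = dot u v.
Proof.
by move=> [A1 _]; rewrite !dotE_mx trmx_mul mulmxA -(mulmxA u^T) (mulmx1C A1) mulmx1.
Qed.

Lemma is_derive_dot {R : realType} (v w : R -> 'cV[R]_3) (t : R) :
  (forall j, derivable (fun s => v s j 0) t 1) ->
  (forall j, derivable (fun s => w s j 0) t 1) ->
  is_derive t 1 (fun s => dot (v s) (w s))
    (dot (\col_j 'D_1 (fun s => v s j 0) t) (w t) +
     dot (v t) (\col_j 'D_1 (fun s => w s j 0) t)).
Proof.
move=> dv dw.
have -> : (fun s => dot (v s) (w s)) = \sum_j (fun s => v s j 0 * w s j 0).
  by apply/funext => s; rewrite fct_sumE.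
rewrite -big_split /=; apply: is_derive_eq.
  by apply: is_derive_sum => j; apply: is_deriveM; apply/derivableP.
apply: eq_bigr => j _; rewrite !mxE /GRing.scale /=.
by ring.
Qed.

(* The weights [s i] are the Lagrange multipliers of the distance constraints. *)
Lemma weights_critical {R : realType} {n : nat} (p : config R n) (s c : 'I_n -> R) :
  Bn R n p -> \sum_i s i != 0 ->
  (forall i, s (ordS i) *: p.1 (ordS (ordS i)) + s i *: p.1 i = c i *: p.1 (ordS i)) ->
  critical_point (orbitSO3 p).
Proof.
move=> bp s0 hs; split; first by exists p.
move=> C [g [sg bg Cg]] C0.
(* The lift passes through some rotation of [p], so the weight relation must be transported by
   [A]. *)
have [A sA gA] : orbitSO3 p (g 0).
  by rewrite -C0 (nbhs_singleton Cg); exact: orbit_refl.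
have gE i : (g 0).1 i = A *m p.1 i by rewrite -gA.
have a0E : (g 0).2 = p.2 by rewrite -gA.
have /BnP[_ a0pi _] := bp.
have hg i : s (ordS i) *: (g 0).1 (ordS (ordS i)) + s i *: (g 0).1 i =
    c i *: (g 0).1 (ordS i).
  by rewrite !gE !scalemxAr -mulmxDr hs.
have dg i j : derivable (fun t => (g t).1 i j 0) 0 1.
  by have /= [h _] := nbhs_singleton sg 0%N; exact: h.
have da : derivable (fun t => (g t).2) 0 1.
  by have /= [_ h] := nbhs_singleton sg 0%N; exact: h.
pose v i := \col_j 'D_1 (fun t => (g t).1 i j 0) 0.
have vg i : dot (v i) ((g 0).1 i) = 0.
  have d1 := is_derive_dot _ _ 0 (dg i) (dg i).
  have d2 : is_derive (0 : R) 1 (fun t => dot ((g t).1 i) ((g t).1 i)) 0.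
    have h : \forall t \near (0 : R), 1 = dot ((g t).1 i) ((g t).1 i).
      by apply: filterS bg => t /BnP[h _ _]; rewrite h.
    by apply: (near_eq_is_derive h); exact: is_derive_cst.
  have := @derive_val _ _ _ _ _ _ _ d1; rewrite (@derive_val _ _ _ _ _ _ _ d2).
  by rewrite -/(v i) (dotC _ (v i)); lra.
have va i : dot (v i) ((g 0).1 (ordS i)) + dot ((g 0).1 i) (v (ordS i)) =
    - sin p.2 * 'D_1 (fun t => (g t).2) 0.
  have d1 := is_derive_dot _ _ 0 (dg i) (dg (ordS i)).
  have d2 : is_derive (0 : R) 1 (fun t => dot ((g t).1 i) ((g t).1 (ordS i)))
      (- sin (g 0).2 * 'D_1 (fun t => (g t).2) 0).
    have h : \forall t \near (0 : R),
        (cos \o (fun t => (g t).2)) t = dot ((g t).1 i) ((g t).1 (ordS i)).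
      by apply: filterS bg => t /BnP[_ _ h]; rewrite h.
    by apply: (near_eq_is_derive h); apply: is_derive1_comp; exact/derivableP.
  have := @derive_val _ _ _ _ _ _ _ d1; rewrite (@derive_val _ _ _ _ _ _ _ d2).
  by rewrite a0E => ->.
have : \sum_i s i * (- sin p.2 * 'D_1 (fun t => (g t).2) 0) = 0.
  transitivity (\sum_i s i * dot (v i) ((g 0).1 (ordS i)) +
                \sum_i s i * dot ((g 0).1 i) (v (ordS i))).
    by rewrite -big_split /=; apply: eq_bigr => i _; rewrite -mulrDr va.
  (* Shifting the first sum collects all terms containing the velocity of one vertex. By the weight
     relation they are its product with a multiple of the vertex itself, which vanishes by tangency
     to the sphere. *)
  rewrite (reindex_inj (@ordS_inj n)) -big_split big1 //= => i _.
  rewrite (dotC ((g 0).1 i)) -!dotZr -dotDr hg dotZr vg mulr0 //.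
rewrite -mulr_suml => /eqP; rewrite !mulf_eq0 (negPf s0) oppr_eq0 /=.
rewrite gt_eqF ?sin_gt0_pi//= => /eqP dE.
have h : \forall t \near (0 : R), (g t).2 = (mu \o C) t.
  by apply: filterS Cg => t /= ->; rewrite mu_orbit.
by apply: (near_eq_is_derive h); apply: (is_derive_eq _ dE); exact/derivableP.
Qed.

(** * Normal form of great-circle polygons *)

Lemma big_ord3 {R : pzSemiRingType} (F : 'I_3 -> R) : \sum_i F i = F 0 + F 1 + F 2.
Proof.
rewrite !big_ord_recl big_ord0 addr0 addrA.
by congr (_ + _ + _); congr F; exact: val_inj.
Qed.

Lemma det_mx22 {R : comPzRingType} (A : 'M[R]_2) :
  \det A = A 0 0 * A 1 1 - A 0 1 * A 1 0.
Proof.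
rewrite (expand_det_row _ 0) !big_ord_recl big_ord0 /cofactor !det_mx11 !mxE.
rewrite (_ : lift ord0 ord0 = 1 :> 'I_2); last exact: val_inj.
rewrite (_ : lift 1 0 = 0 :> 'I_2); last exact: val_inj.
by rewrite /= !add0n expr0 expr1; ring.
Qed.

Lemma det_mx33 {R : comPzRingType} (A : 'M[R]_3) : \det A =
  A 0 0 * (A 1 1 * A 2 2 - A 1 2 * A 2 1) - A 0 1 * (A 1 0 * A 2 2 - A 1 2 * A 2 0)
  + A 0 2 * (A 1 0 * A 2 1 - A 1 1 * A 2 0).
Proof.
rewrite (expand_det_row _ 0) big_ord3 /cofactor.
have lE : [/\ lift 0 0 = 1 :> 'I_3, lift 0 1 = 2 :> 'I_3, lift 1 0 = 0 :> 'I_3,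
     lift 1 1 = 2 :> 'I_3 & lift 2 0 = 0 :> 'I_3 /\ lift 2 1 = 1 :> 'I_3].
  by repeat split; exact: val_inj.
have [e1 e2 e3 e4 [e5 e6]] := lE.
rewrite !det_mx22 !mxE !e1 !e2 !e3 !e4 !e5 !e6 /=.
rewrite !add0n !expr0 !expr1 !expr2; ring.
Qed.

Lemma dot3 {R : realType} (u v : 'cV[R]_3) :
  dot u v = u 0 0 * v 0 0 + u 1 0 * v 1 0 + u 2 0 * v 2 0.
Proof. exact: big_ord3. Qed.

Definition cross {R : realType} (u v : 'cV[R]_3) : 'cV[R]_3 :=
  \col_i (if i == 0 then u 1 0 * v 2 0 - u 2 0 * v 1 0
          else if i == 1 then u 2 0 * v 0 0 - u 0 0 * v 2 0
          else u 0 0 * v 1 0 - u 1 0 * v 0 0).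

Definition frame {R : realType} (u v : 'cV[R]_3) : 'M[R]_3 :=
  \matrix_(i, j) (if j == 0 then u i 0 else if j == 1 then v i 0 else cross u v i 0).

Definition circle_pt {R : realType} (x : R) : 'cV[R]_3 :=
  \col_i (if i == 0 then cos x else if i == 1 then sin x else 0).

Lemma frame_circle_pt {R : realType} (u v : 'cV[R]_3) x :
  frame u v *m circle_pt x = cos x *: u + sin x *: v.
Proof.
apply/matrixP => i j; rewrite ord1 !mxE big_ord3 !mxE /=.
by ring.
Qed.

(** Lagrange's identity makes the cross product a unit vector, and the determinant equals its
    squared length. *)
Lemma frame_SO3 {R : realType} (u v : 'cV[R]_3) :
  dot u u = 1 -> dot v v = 1 -> dot u v = 0 -> SO3 R (frame u v).
Proof.
rewrite !dot3 => u1 v1 uv.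
have w1 : (u 1 0 * v 2 0 - u 2 0 * v 1 0) ^+ 2 +
    (u 2 0 * v 0 0 - u 0 0 * v 2 0) ^+ 2 +
    (u 0 0 * v 1 0 - u 1 0 * v 0 0) ^+ 2 = 1.
  transitivity ((u 0 0 * u 0 0 + u 1 0 * u 1 0 + u 2 0 * u 2 0) *
     (v 0 0 * v 0 0 + v 1 0 * v 1 0 + v 2 0 * v 2 0) -
     (u 0 0 * v 0 0 + u 1 0 * v 1 0 + u 2 0 * v 2 0) ^+ 2); first by ring.
  by rewrite u1 v1 uv; ring.
split; last by rewrite det_mx33 !mxE /= -w1; ring.
apply: mulmx1C; apply/matrixP => i j; rewrite !mxE big_ord3 !mxE.
have ord3 (k : 'I_3) : [\/ k = 0, k = 1 | k = 2].
  by case: k => -[|[|[|]]] // h; [apply: Or31|apply: Or32|apply: Or33]; exact: val_inj.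
have [->|->|->] := ord3 i; have [->|->|->] := ord3 j; rewrite /= ?mulr1n ?mulr0n.
all: try by ring.
- by rewrite -[RHS]u1; ring.
- by rewrite -[RHS]uv; ring.
- by rewrite -[RHS]uv; ring.
- by rewrite -[RHS]v1; ring.
- by rewrite -[RHS]w1; ring.
Qed.

Lemma dot_circle_pt {R : realType} (x y : R) :
  dot (circle_pt x) (circle_pt y) = cos (x - y).
Proof. by rewrite dot3 !mxE /= cosB; ring. Qed.

Lemma circle_pt_cos {R : realType} (x y : R) :
  circle_pt x = circle_pt y -> cos x = cos y.
Proof. by move=> /matrixP /(_ 0 0); rewrite !mxE. Qed.

Lemma circle_pt_sin {R : realType} (x y : R) :
  circle_pt x = circle_pt y -> sin x = sin y.
Proof. by move=> /matrixP /(_ 1 0); rewrite !mxE. Qed.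

Lemma eq_circle_pt {R : realType} (x y : R) :
  cos x = cos y -> sin x = sin y -> circle_pt x = circle_pt y.
Proof. by move=> c s; apply/matrixP => i j; rewrite !mxE c s. Qed.

Lemma circle_pt_addr {R : realType} (x y z : R) :
  circle_pt x = circle_pt y -> circle_pt (x + z) = circle_pt (y + z).
Proof.
by move=> h; apply: eq_circle_pt; rewrite ?cosD ?sinD (circle_pt_cos _ _ h)
  (circle_pt_sin _ _ h).
Qed.

Lemma circle_pt_period {R : realType} (x : R) k :
  circle_pt (x + pi *+ 2 *+ k) = circle_pt x.
Proof.
by apply: eq_circle_pt; [apply: periodicn; exact: cosD2pi|apply: periodicn; exact: sinD2pi].
Qed.

(** Subtracting full turns leaves [y] in [[0, 2 pi)]; [cos y = 1] means [sin (y / 2) = 0] with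
    [y / 2] in [[0, pi)], hence [y = 0]. *)
Lemma cos_eq1 {R : realType} (x : R) : 0 <= x -> cos x = 1 ->
  exists k : nat, x = pi *+ 2 *+ k.
Proof.
move=> x0 c1; have p0 : 0 < pi *+ 2 :> R by rewrite mulrn_wgt0// pi_gt0.
have /andP[] := truncn_itv (divr_ge0 x0 (ltW p0)).
set k := Num.truncn _; rewrite ler_pdivlMr// ltr_pdivrMr// => h1 h2.
exists k; apply/eqP; rewrite -subr_eq0; apply/eqP.
set y := x - _; have y0 : 0 <= y by rewrite /y -mulr_natl; lra.
have y1 : y < pi *+ 2.
  by move: h2; rewrite /y -(mulr_natl _ k) -natr1; lra.
have : cos y = 1.
  by rewrite -c1 -(periodicn (@cosD2pi R) k y) subrK.
have -> : y = (y / 2) *+ 2 by rewrite -mulr_natr; field.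
rewrite cos_mulr2n => h; have s0 : sin (y / 2) ^+ 2 = 0 by rewrite sin2cos2; lra.
have [yp|yn] := ltP 0 y; last by rewrite (_ : y = 0) ?mul0r ?mul0rn//; lra.
have : 0 < sin (y / 2) by apply: sin_gt0_pi; move: y1; rewrite -mulr_natl => y1; lra.
by move: s0 => /eqP; rewrite expf_eq0 /= => /eqP ->; rewrite ltxx.
Qed.

(* Great-circle polygons: [A] is the set of edges traversed clockwise, and the
   polygon closes up after winding [k] times. *)
Definition winding_sum {n : nat} (A : {set 'I_n}) : nat := (n - 2 * #|A|)%N.

(** The argument is a natural number so that [phase A n], the total around the polygon, makes
    sense. *)
Definition phase {R : realType} {n : nat} (A : {set 'I_n}) (j : nat) : R :=
  \sum_(i < n | (i < j)%N) (-1) ^+ (i \in A).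

Definition circle_config {R : realType} {n : nat} (a : R) (A : {set 'I_n}) :
    config R n :=
  (fun j : 'I_n => circle_pt (a * phase A j), a).

Definition side {R : realType} {n : nat} (x : {set 'I_n} * 'I_n) : R :=
  pi *+ 2 *+ x.2 / (winding_sum x.1)%:R.

(** The first condition picks one of [A] and its complement, which give the same polygon up to a
    half-turn about the first vertex. The last one says that the side is less than [pi]; it also
    bounds the winding number by [n], so ['I_n] can hold it. *)
Definition closed_polygons (n : nat) : {set {set 'I_n} * 'I_n} :=
  [set x : {set 'I_n} * 'I_n |
    [&& (2 * #|x.1| < n)%N, (0 < x.2)%N & (2 * x.2 < winding_sum x.1)%N]].

Lemma phase_total {R : realType} {n : nat} (A : {set 'I_n}) :
  phase A n = n%:R - 2 * #|A|%:R :> R.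
Proof.
rewrite /phase -sum1_card natr_sum mulr_sumr.
rewrite (eq_bigl xpredT); last by move=> i; rewrite ltn_ord.
rewrite [in RHS]big_mkcond /=.
rewrite -[X in X%:R](card_ord n) -sum1_card natr_sum -sumrB.
by apply: eq_bigr => i _; case: (i \in A); rewrite ?expr1 ?expr0; ring.
Qed.

Lemma phaseS {R : realType} {n : nat} (A : {set 'I_n}) (j : 'I_n) :
  phase A j.+1 = phase A j + (-1) ^+ (j \in A) :> R.
Proof.
rewrite /phase (bigD1 j) //= addrC; congr (_ + _).
by apply: eq_bigl => i; rewrite ltnS ltn_neqAle andbC -val_eqE.
Qed.

(** Closedness makes the edge from the last vertex back to the first obey the same rule as the
    others. *)
Lemma circle_config_step {R : realType} {n : nat} (a : R) (A : {set 'I_n}) (j : 'I_n) :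
  circle_pt (a * phase A n) = circle_pt 0 ->
  (circle_config a A).1 (ordS j) =
  circle_pt (a * phase A j + a * (-1) ^+ (j \in A)).
Proof.
move=> closed; rewrite /= -mulrDr -phaseS.
have [jn|jn] := ltnP j.+1 n; first by rewrite modn_small.
have -> : j.+1 = n by apply/eqP; rewrite eqn_leq jn andbT.
rewrite modnn closed (_ : phase A 0 = 0) ?mulr0//.
by rewrite /phase big_pred0.
Qed.

Lemma circle_config_Bn {R : realType} {n : nat} (a : R) (A : {set 'I_n}) :
  0 < a < pi -> circle_pt (a * phase A n) = circle_pt 0 ->
  Bn R n (circle_config a A).
Proof.
move=> a0 closed; apply/BnP; split=> // i.
  by rewrite dot_circle_pt subrr cos0.
rewrite circle_config_step// dot_circle_pt opprD addrA subrr sub0r cosN /=.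
by case: (i \in A); rewrite ?expr1 ?expr0 ?mulr1// mulrN1 cosN.
Qed.

Lemma circle_pt_sign {R : realType} (x a : R) (b : bool) :
  circle_pt (x + a * (-1) ^+ b) =
  cos a *: circle_pt x + (-1) ^+ b *: (sin a *: circle_pt (x + pi / 2)).
Proof.
apply/matrixP => i j; rewrite !mxE cosD sinD cosDpihalf sinDpihalf.
by case: b; rewrite ?expr1 ?expr0 ?mulrN1 ?mulr1 ?cosN ?sinN;
  case: eqP => _; [ring | case: eqP => _; ring | ring | case: eqP => _; ring].
Qed.

(** The multipliers are the edge signs. The neighbours of a vertex have tangential parts
    [s_{i+1} sin a] and [- s_i sin a], which cancel after weighting since signs square to 1. *)
Lemma circle_config_critical {R : realType} {n : nat} (a : R) (A : {set 'I_n}) :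
  0 < a < pi -> circle_pt (a * phase A n) = circle_pt 0 ->
  phase A n != 0 :> R -> critical_point (orbitSO3 (circle_config a A)).
Proof.
move=> a0 closed nz; pose s (i : 'I_n) : R := (-1) ^+ (i \in A).
apply: (weights_critical _ s (fun i => (s i + s (ordS i)) * cos a)).
- exact: circle_config_Bn.
- by move: nz; rewrite /phase (eq_bigl xpredT)// => i; rewrite ltn_ord.
move=> i; have e1 := circle_config_step a A (ordS i) closed.
have e2 := circle_config_step a A i closed.
rewrite e1 (circle_pt_addr _ _ _ e2) e2.
set x := a * phase A i + _.
have -> : (circle_config a A).1 i = circle_pt (x + a * (-1) ^+ (i \notin A)).
  by rewrite /x /=; congr circle_pt; case: (i \in A); rewrite /= ?expr0 ?expr1; ring.
rewrite !circle_pt_sign /s; set p := circle_pt x; set q := sin a *: _.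
case: (i \in A); case: (ordS i \in A); rewrite /= ?expr1 ?expr0;
  by apply/matrixP => k l; rewrite !mxE; ring.
Qed.

Section valid.
Context {R : realType} {n : nat} (x : {set 'I_n} * 'I_n).
Hypothesis xv : x \in closed_polygons n.

Lemma closed_phase : phase x.1 n = (winding_sum x.1)%:R :> R.
Proof.
move: xv; rewrite inE => /and3P[h _ _].
by rewrite phase_total /winding_sum natrB ?natrM// ltnW.
Qed.

Lemma winding_sum_gt0 : (0 < winding_sum x.1)%N.
Proof. by move: xv; rewrite inE => /and3P[h _ _]; rewrite subn_gt0. Qed.

Lemma side_itv : 0 < (side x : R) < pi.
Proof.
move: xv; rewrite inE => /and3P[_ k0 k2]; have s0 := winding_sum_gt0.
have p0 : 0 < pi :> R := pi_gt0 R.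
have s0' : 0 < (winding_sum x.1)%:R :> R by rewrite ltr0n.
rewrite /side; apply/andP; split; first by rewrite divr_gt0// pmulrn_lgt0// pmulrn_lgt0.
by rewrite ltr_pdivrMr// -mulrnA -(mulr_natr pi) ltr_pM2l// ltr_nat.
Qed.

Lemma side_closed : circle_pt (side x * phase x.1 n) = circle_pt 0 :> 'cV[R]_3.
Proof.
rewrite closed_phase divfK; last by rewrite pnatr_eq0 -lt0n winding_sum_gt0.
by rewrite -[X in circle_pt X]add0r circle_pt_period.
Qed.

Lemma closed_polygon_critical :
  critical_point (orbitSO3 (circle_config (side x : R) x.1)).
Proof.
apply: circle_config_critical; [exact: side_itv|exact: side_closed|].
by rewrite closed_phase pnatr_eq0 -lt0n winding_sum_gt0.
Qed.

End valid.

(** * Classification of great-circle polygons up to rotation *)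

Lemma cos_mulr2n_neq1 {R : realType} (a : R) : 0 < a < pi -> cos (a *+ 2) != 1.
Proof.
move=> a0; rewrite cos_mulr2n cos2sin2; have s0 := sin_gt0_pi a0.
have s2 : 0 < sin a ^+ 2 by rewrite exprn_gt0.
by apply/eqP; lra.
Qed.

(** Detects fold-backs by a rotation-invariant quantity: vertices two steps apart differ by the
    angle 0 or [2 a], up to sign, and [0 < 2 a < 2 pi]. *)
Lemma dot_circle_config {R : realType} {n : nat} (a : R) (A : {set 'I_n}) (j : 'I_n) :
  0 < a < pi -> circle_pt (a * phase A n) = circle_pt 0 ->
  (dot ((circle_config a A).1 j) ((circle_config a A).1 (ordS (ordS j))) == 1) =
  ((j \in A) != (ordS j \in A)).
Proof.
move=> a0 closed; rewrite circle_config_step// (circle_pt_addr _ _ _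
  (circle_config_step a A j closed)) dot_circle_pt.
have /negPf c2 := cos_mulr2n_neq1 a a0.
set y := a * phase A j.
case: (j \in A); case: (ordS j \in A); rewrite ?expr0 ?expr1 /=.
- by rewrite (_ : _ - _ = a *+ 2) ?c2//; ring.
- by rewrite (_ : _ - _ = 0) ?cos0 ?eqxx//; ring.
- by rewrite (_ : _ - _ = 0) ?cos0 ?eqxx//; ring.
- by rewrite (_ : _ - _ = - (a *+ 2)) ?cosN ?c2//; ring.
Qed.

Lemma circle_config_inj {R : realType} {n : nat} :
  {in closed_polygons n &,
     injective (fun x => orbitSO3 (circle_config (side x : R) x.1))}.
Proof.
move=> x y xv yv xy.
have [M sM Mxy] : orbitSO3 (circle_config (side x : R) x.1) (circle_config (side y : R) y.1).
  by rewrite xy; exact: orbit_refl.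
have axy : side x = side y :> R by have := congr1 snd Mxy.
have uxy j : (circle_config (side y : R) y.1).1 j = M *m (circle_config (side x : R) x.1).1 j.
  by rewrite -Mxy.
have turn j : ((j \in x.1) != (ordS j \in x.1)) = ((j \in y.1) != (ordS j \in y.1)).
  rewrite -(dot_circle_config (side x : R))//; last 2 first.
    exact: side_itv.
    exact: side_closed.
  rewrite -(dot_circle_config (side y : R))//; last 2 first.
    exact: side_itv.
    exact: side_closed.
  by rewrite !uxy dot_SO3.
(* The winding number [x.2] serves here only as an available index from which to propagate the
   comparison of signs. *)
pose b := (x.2 \in x.1) (+) (x.2 \in y.1).
have memb j : (j \in y.1) = b (+) (j \in x.1).
  rewrite -(iter_cyc_index x.2 j); elim: (cyc_index _ _) => [|k IH] /=.
    by rewrite /b; case: (_ \in x.1); case: (_ \in _).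
  move: (turn (iter k (@ordS n) x.2)); rewrite IH.
  clearbody b; move: (ordS _ \in x.1) (iter k _ _ \in x.1) (ordS _ \in y.1).
  by move: b {IH} => [] [] [] [].
have xy1 : x.1 = y.1.
  (* A common flip would make the two sets complementary, yet both have fewer than [n / 2]
     elements. *)
  case: b memb => memb; last by apply/setP => j; rewrite memb.
  have yC : y.1 = ~: x.1 by apply/setP => j; rewrite memb inE.
  have := cardsC x.1; rewrite -yC card_ord => h.
  move: xv yv; rewrite !inE => /and3P[h1 _ _] /and3P[h2 _ _].
  by move: h h1 h2; move: #|x.1| #|y.1| => p q; lia.
have s0 : (winding_sum x.1)%:R != 0 :> R.
  by rewrite pnatr_eq0 -lt0n; exact: winding_sum_gt0.
have : x.2 = y.2.
  move: axy; rewrite /side -xy1 => /(mulIf (invr_neq0 s0)).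
  have p0 : pi *+ 2 != 0 :> R by rewrite gt_eqF// pmulrn_lgt0// pi_gt0.
  by rewrite -!(mulr_natr (pi *+ 2)) => /(mulfI p0)/eqP; rewrite eqr_nat => /eqP/val_inj.
by case: x y xy1 {xv yv xy Mxy axy uxy turn b memb s0} => [x1 x2] [y1 y2] /= -> ->.
Qed.

(** When [f] marks fold-backs, this is the sign of edge [k] relative to the first edge. *)
Fixpoint turn_parity (f : nat -> bool) (k : nat) : bool :=
  if k is k'.+1 then turn_parity f k' (+) f k' else false.

Lemma odd_majority {n : nat} (A : {set 'I_n}) : odd n ->
  exists b : bool, (2 * #|[set i | b (+) (i \in A)]%SET| < n)%N.
Proof.
move=> no; have := cardsC A; rewrite card_ord => h.
have [l|g] := ltnP (2 * #|A|)%N n.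
  exists false; rewrite (_ : [set _ | _]%SET = A)//.
  by apply/setP => i; rewrite inE.
exists true; rewrite (_ : [set _ | _]%SET = ~: A); last by apply/setP => i; rewrite !inE.
by lia.
Qed.

Lemma great_circle_circle_config {R : realType} {n : nat} (p : config R n) :
  odd n -> Bn R n p -> on_great_circle p ->
  exists2 x, x \in closed_polygons n &
    orbitSO3 p = orbitSO3 (circle_config (side x : R) x.1).
Proof.
move=> no /BnP[u1 a0 ua] gc; set a := p.2.
have n0 : (0 < n)%N by case: (n) no.
pose i0 := Ordinal n0; pose U k := p.1 (iter k (@ordS n) i0).
have U1 k : dot (U k) (U k) = 1 by exact: u1.
have Ua k : dot (U k) (U k.+1) = cos a by exact: ua.
have iterE (j : 'I_n) : iter j (@ordS n) i0 = j.
  by apply: ord_inj; rewrite val_iter_ordS add0n modn_small.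
pose t := turn_parity (fun k => U k.+2 == U k).
have [b hA] := odd_majority [set i : 'I_n | t i]%SET no.
set A := [set _ | _]%SET in hA.
have memA (j : 'I_n) : (j \in A) = b (+) t j by rewrite !inE.
have s0 : 0 < sin a by exact: sin_gt0_pi.
have sn0 : sin a != 0 by rewrite gt_eqF.
(* The unit tangent at the first vertex towards the second, reversed when the majority choice [b]
   flips all signs. *)
pose w := ((-1) ^+ b / sin a) *: (U 1%N - cos a *: U 0%N).
have sb : (-1) ^+ b * (-1) ^+ b = 1 :> R by case: (b); rewrite ?expr0 ?expr1; ring.
have w1 : dot w w = 1.
  rewrite /w !dotE !U1 (dotC (U 1%N)) Ua.
  transitivity ((-1) ^+ b * (-1) ^+ b * (1 - cos a ^+ 2) / sin a ^+ 2); first by field.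
  by rewrite sb mul1r -sin2cos2 divff// expf_neq0.
have uw : dot (U 0%N) w = 0 by rewrite /w !dotE U1 Ua; ring.
have sM := frame_SO3 (U 0%N) w (U1 0%N) w1 uw.
set M := frame _ _ in sM.
have phase0 : phase A 0 = 0 :> R by rewrite /phase big_pred0.
(* Two consecutive vertices are carried because the great-circle relation is a second-order
   recurrence. *)
have UM k : (k < n)%N -> U k = M *m circle_pt (a * phase A k) /\
    U k.+1 = M *m circle_pt (a * phase A k.+1).
  elim: k => [|k IH] kn.
    rewrite (phaseS A (Ordinal kn)) phase0 !mulr0 add0r memA /= addbF.
    rewrite !frame_circle_pt cos0 sin0 scale1r scale0r addr0; split=> //.
    rewrite /w scalerA.
    have -> : sin (a * (-1) ^+ b) * ((-1) ^+ b / sin a) = 1.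
      rewrite (_ : sin _ = (-1) ^+ b * sin a); last first.
        by case: (b); rewrite ?expr0 ?expr1 ?mulr1 ?mul1r ?mulrN1 ?mulN1r ?sinN.
      by rewrite mulrACA sb divff// mulr1.
    have -> : cos (a * (-1) ^+ b) = cos a.
      by case: (b); rewrite ?expr0 ?expr1 ?mulr1 ?mulrN1 ?cosN.
    by rewrite scale1r addrC subrK.
  have [Uk Uk1] := IH (ltnW kn); split=> //.
  have tS : t k.+1 = t k (+) (U k.+2 == U k) by [].
  rewrite (phaseS A (Ordinal kn)) memA tS /=.
  have pk := phaseS (R := R) A (Ordinal (ltnW kn)); rewrite memA /= in pk.
  have [e|e] := eqVneq (U k.+2) (U k).
    rewrite e Uk addbT pk; congr (_ *m circle_pt (_ * _)).
    by case: (b); case: (t k); rewrite /= ?expr0 ?expr1; ring.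
  have [e'|e'] := gc (iter k (@ordS n) i0); first by case/eqP: e; exact: e'.
  rewrite addbF; have -> : U k.+2 = (2 * cos a) *: U k.+1 - U k.
    by have h : U k.+2 + U k = (2 * cos a) *: U k.+1 := e'; rewrite -h addrK.
  rewrite Uk1 Uk scalemxAr -mulmxBr; congr (_ *m _).
  set y := a * phase A k.+1.
  have -> : a * phase A k = y + a * (-1) ^+ ~~ (b (+) t k).
    by rewrite /y pk; case: (b (+) t k); rewrite /= ?expr0 ?expr1; ring.
  rewrite mulrDr -/y !circle_pt_sign; apply/matrixP => i j; rewrite !mxE.
  by case: (b (+) t k); rewrite /= ?expr0 ?expr1; ring.
have nlast : (n.-1 < n)%N by rewrite prednK.
have [_] := UM _ nlast; rewrite prednK//.
have -> : U n = M *m circle_pt 0.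
  rewrite frame_circle_pt cos0 sin0 scale1r scale0r addr0 /U; congr (p.1 _).
  by apply: ord_inj; rewrite val_iter_ordS add0n modnn.
move=> /(congr1 (mulmx M^T)); rewrite !mulmxA (mulmx1C sM.1) !mul1mx => closed.
have pn : phase A n = (winding_sum A)%:R :> R.
  by rewrite phase_total /winding_sum natrB ?natrM// ltnW.
have ws0 : (0 < winding_sum A)%N by rewrite subn_gt0.
have ws0R : 0 < (winding_sum A)%:R :> R by rewrite ltr0n.
have /andP[al ar] := a0; rewrite -/a in al ar.
have aw : 0 < a * (winding_sum A)%:R by rewrite mulr_gt0.
have [|k hk] := cos_eq1 (a * (winding_sum A)%:R) (ltW aw).
  by rewrite -pn -(circle_pt_cos _ _ closed) cos0.
have p0 : 0 < pi :> R := pi_gt0 R.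
have k0 : (0 < k)%N.
  by rewrite lt0n; apply/eqP => k0; move: aw; rewrite hk k0 mulr0n ltxx.
(* From [2 pi k = a s] and [a < pi]. *)
have k2 : (2 * k < winding_sum A)%N.
  rewrite -(ltr_nat R) -(ltr_pM2l p0) [X in X < _]mulr_natr mulrnA -hk.
  by rewrite ltr_pM2r.
have kn : (k < n)%N.
  by move: k2; rewrite /winding_sum; lia.
have xv : (A, Ordinal kn) \in closed_polygons n by rewrite inE /= hA k0 k2.
exists (A, Ordinal kn) => //.
have -> : side (A, Ordinal kn) = a by rewrite /side /= -hk mulfK// gt_eqF.
rewrite -(orbit_rotate M (circle_config a A))//; congr orbitSO3; rewrite [LHS]surjective_pairing.
congr (_, _); apply/funext => j /=.
by have [<- _] := UM j (ltn_ord j); rewrite /U iterE.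
Qed.

(** * Critical points and values as images of a finite set *)

Lemma UnE {R : realType} {n : nat} : odd n -> (2 < n)%N ->
  Un R n = [set orbitSO3 (circle_config (side x : R) x.1) | x in [set` closed_polygons n]].
Proof.
move=> no n2; apply/seteqP; split=> [X XU|X [x xv <-]].
  have [[p bp pX] _] := XU; rewrite /Un /= -pX in XU.
  have gc := critical_great_circle p n2 bp XU.
  by have [x xv e] := great_circle_circle_config p no bp gc; exists x; rewrite // -pX e.
exact: closed_polygon_critical.
Qed.

(** The image is finite, so [setcard] is its true cardinality and not the default 0. *)
Lemma setcard_image {T : finType} {U : choiceType} (f : T -> U) (S : {set T}) :
  {in S &, injective f} -> setcard [set f x | x in [set` S]] = #|S|.
Proof.
move=> fi; rewrite /setcard.
have -> : fset_set [set f x | x in [set` S]] = [fset f x | x in S]%fset.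
  apply/fsetP => y; rewrite in_fset_set; last first.
    by apply: finite_image; exact: finite_finset.
  apply/idP/idP.
    by rewrite inE => -[x xS <-]; apply/imfsetP; exists x.
  by move=> /imfsetP[x /= xS ->]; rewrite inE; exists x.
by rewrite card_in_imfset//= cardE.
Qed.

Lemma card_Un {R : realType} {n : nat} : odd n -> (2 < n)%N ->
  setcard (Un R n) = #|closed_polygons n|.
Proof. by move=> no n2; rewrite UnE// setcard_image//; exact: circle_config_inj. Qed.

Lemma VnE {R : realType} {n : nat} : odd n -> (2 < n)%N ->
  Vn R n = [set side x | x in [set` closed_polygons n]].
Proof.
move=> no n2; rewrite /Vn UnE//; apply/seteqP; split=> [r [X [x xv <-] <-]|r [x xv <-]].
  by exists x; rewrite // mu_orbit.
exists (orbitSO3 (circle_config (side x : R) x.1)); last by rewrite mu_orbit.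
by exists x.
Qed.

(** * Wallis' bounds for the central binomial coefficient *)

(** The primitive of [cos ^ n] vanishing at 0, by the reduction formula; its values at [pi / 2] are
    the Wallis integrals. *)
Fixpoint cos_primitive {R : realType} (n : nat) (x : R) : R :=
  match n with
  | 0 => x
  | 1 => sin x
  | k.+2 => (sin x * cos x ^+ k.+1 + k.+1%:R * cos_primitive k x) / k.+2%:R
  end.

Lemma is_derive_cos_primitive {R : realType} (n : nat) (x : R) :
  is_derive x 1 (cos_primitive n) (cos x ^+ n).
Proof.
suff : is_derive x 1 (cos_primitive n) (cos x ^+ n) /\
  is_derive x 1 (cos_primitive n.+1) (cos x ^+ n.+1) by case.
elim: n => [|n [IH1 IH2]].
  split; first by rewrite expr0; exact: is_derive_id.
  by rewrite expr1; exact: is_derive_sin.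
split=> //.
have d1 : is_derive x 1 (fun y => cos y ^+ n.+1) ((n.+1%:R * cos x ^+ n) * - sin x).
  have := @is_deriveX R R (@cos R) n.+1 x 1 _ (is_derive_cos x).
  by rewrite exprfctE.
have d2 := @is_deriveM R R (@sin R) _ x 1 _ _ (is_derive_sin x) d1.
have d3 := @is_deriveZ R R R _ (n.+1%:R) x 1 _ IH1.
have d4 := @is_deriveZ R R R _ (n.+2%:R^-1) x 1 _ (@is_deriveD R R R _ _ x 1 _ _ d2 d3).
have -> : cos_primitive n.+2 = n.+2%:R^-1 \*: (sin * (fun y => cos y ^+ n.+1) +
    n.+1%:R \*: cos_primitive n) :> (R -> R).
  by apply/funext => y /=; rewrite mulrC.
apply: (is_derive_eq d4); rewrite /GRing.scale /=.
have n2 : n.+2%:R != 0 :> R by rewrite pnatr_eq0.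
apply: (mulfI n2); rewrite mulrA divff// mul1r.
have s2 : sin x * sin x = 1 - cos x ^+ 2 by rewrite -sin2cos2 expr2.
transitivity (- n.+1%:R * cos x ^+ n * (sin x * sin x) + cos x ^+ n.+2 +
    n.+1%:R * cos x ^+ n); first by rewrite !exprS; ring.
by rewrite s2 -[in RHS]natr1 !exprS; ring.
Qed.

(** Mean value theorem for the difference of the primitives, whose derivative [cos^n (1 - cos)] is
    nonnegative on [[0, pi / 2]]. *)
Lemma cos_primitive_pihalf_decr {R : realType} (n : nat) :
  cos_primitive n.+1 (pi / 2) <= cos_primitive n (pi / 2) :> R.
Proof.
pose f := cos_primitive n - cos_primitive n.+1 : R -> R.
have df (x : R) : is_derive x 1 f (cos x ^+ n - cos x ^+ n.+1).
  by apply: is_deriveB; exact: is_derive_cos_primitive.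
have p0 : 0 <= pi / 2 :> R by rewrite divr_ge0// pi_ge0.
have cf : {within `[0, pi / 2], continuous f}.
  apply/continuous_subspaceT => x.
  by apply/differentiable_continuous/derivable1_diffP; have [] := df x.
have [c + e] := MVT_segment p0 (fun x _ => df x) cf.
rewrite in_itv /= => /andP[c0 c1].
have z k : cos_primitive k 0 = 0 :> R.
  suff : cos_primitive k 0 = 0 :> R /\ cos_primitive k.+1 0 = 0 :> R by case.
  elim: k => [|k [h1 h2]]; first by rewrite /= sin0.
  by rewrite h2; split=> //=; rewrite h1 sin0; ring.
have : f (pi / 2) - f 0 = cos_primitive n (pi / 2) - cos_primitive n.+1 (pi / 2).
  by rewrite /f !fctE !z; ring.
rewrite e => h; rewrite -subr_ge0 -h subr0 mulr_ge0//.
have cc : 0 <= cos c by apply: cos_ge0_pihalf; apply/andP; split; lra.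
by rewrite exprS -{1}[cos c ^+ n]mul1r -mulrBl mulr_ge0 ?exprn_ge0// subr_ge0 cos_le1.
Qed.

Lemma cos_primitive_pihalf_rec {R : realType} (n : nat) :
  cos_primitive n.+2 (pi / 2) = n.+1%:R / n.+2%:R * cos_primitive n (pi / 2) :> R.
Proof. by rewrite /= cos_pihalf exprS mul0r mulr0 add0r mulrAC. Qed.

(** By the recursion, [n + 1] times this product does not depend on [n]. *)
Lemma cos_primitive_pihalf_mul {R : realType} (n : nat) :
  cos_primitive n (pi / 2) * cos_primitive n.+1 (pi / 2) =
  pi / (2 * n.+1%:R) :> R.
Proof.
elim: n => [|n IH]; first by rewrite /= sin_pihalf !mulr1.
rewrite cos_primitive_pihalf_rec mulrCA (mulrC (cos_primitive _ _)) IH.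
have n1 : n.+1%:R != 0 :> R by rewrite pnatr_eq0.
have n2 : n.+2%:R != 0 :> R by rewrite pnatr_eq0.
by move: n.+1%:R n.+2%:R n1 n2 => a b a0 b0; field; rewrite a0 b0.
Qed.

Definition central_ratio {R : realType} (m : nat) : R := 'C(2 * m, m)%:R / 4 ^+ m.

Lemma central_ratioS {R : realType} (m : nat) :
  central_ratio m.+1 = (2 * m).+1%:R / (2 * m).+2%:R * central_ratio m :> R.
Proof.
have h : ((m.+1 * 'C(2 * m.+1, m.+1)) = 2 * ((2 * m).+1 * 'C(2 * m, m)))%N.
  rewrite (_ : 2 * m.+1 = (2 * m).+2)%N; last by rewrite mulnS.
  rewrite -(mul_bin_diag (2 * m).+2 m) [in LHS]/=.
  rewrite -(bin_sub (n := (2 * m).+1) (m := m)); last by rewrite ltnW// ltnS leq_pmull.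
  rewrite (_ : (2 * m).+1 - m = m.+1)%N; last first.
    by rewrite subSn ?leq_pmull// mul2n -addnn addnK.
  rewrite (_ : (2 * m).+2 = 2 * m.+1)%N; last by rewrite mulnS.
  by rewrite -mulnA -(mul_bin_diag (2 * m).+1 m).
have hR := congr1 (fun k : nat => k%:R : R) h; rewrite /= !natrM in hR.
have m1 : m.+1%:R != 0 :> R by rewrite pnatr_eq0.
rewrite /central_ratio (_ : (2 * m).+2 = 2 * m.+1)%N; last by lia.
have n4 : (4 : R) ^+ m != 0 by rewrite expf_neq0// pnatr_eq0.
apply: (mulfI m1); rewrite [LHS]mulrA hR exprS natrM.
move: m.+1%:R (4 ^+ m) (2 * m).+1%:R 'C(2 * m, m)%:R m1 n4 => a b c d a0 b0.
by field; rewrite a0 b0.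
Qed.

Lemma cos_primitive_pihalf_even {R : realType} (m : nat) :
  cos_primitive (2 * m) (pi / 2) = central_ratio m * (pi / 2) :> R.
Proof.
elim: m => [|m IH]; first by rewrite /central_ratio muln0 bin0 expr0 divr1 mul1r.
rewrite (_ : 2 * m.+1 = (2 * m).+2)%N; last by lia.
by rewrite cos_primitive_pihalf_rec IH central_ratioS [LHS]mulrA.
Qed.

(* From the monotonicity in [n] of the integral of [cos ^ n] on [0, pi / 2]. *)
Lemma central_ratio_bounds {R : realType} (m : nat) : (0 < m)%N ->
  1 - (2 * m + 1)%N%:R^-1 <= (central_ratio m : R) ^+ 2 * (pi * m%:R) <= 1.
Proof.
move=> m0; have p0 : 0 < pi :> R := pi_gt0 R.
have mR : 0 < m%:R :> R by rewrite ltr0n.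
have c0 : 0 < central_ratio m :> R.
  by rewrite divr_gt0 ?exprn_gt0// ltr0n bin_gt0; lia.
have e := cos_primitive_pihalf_even (R := R) m.
have I0 : 0 < cos_primitive (2 * m) (pi / 2) :> R by rewrite e mulr_gt0// divr_gt0.
have n1 : (2 * m + 1)%N%:R = 2 * m%:R + 1 :> R by rewrite natrD natrM.
apply/andP; split.
  (* Writing [I_n] for the value at [pi / 2]: the lower bound is [I_{2m}^2 >= I_{2m} I_{2m+1}], and
     the upper one below is [I_{2m}^2 <= I_{2m-1} I_{2m}]. *)
  have l := cos_primitive_pihalf_decr (R := R) (2 * m).
  have := cos_primitive_pihalf_mul (R := R) (2 * m).
  move=> h; have : pi / (2 * (2 * m).+1%:R) <= cos_primitive (2 * m) (pi / 2) ^+ 2 :> R.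
    by rewrite -h expr2 ler_pM2l.
  rewrite e -[(2 * m).+1]addn1 n1 ler_pdivrMr; last by lra.
  move=> h'; rewrite -subr_ge0.
  have -> : central_ratio m ^+ 2 * (pi * m%:R) - (1 - (2 * m%:R + 1)^-1) =
    (2 * m%:R / (pi * (2 * m%:R + 1))) *
    ((central_ratio m * (pi / 2)) ^+ 2 * (2 * (2 * m%:R + 1)) - pi) :> R.
    by field; rewrite !gt_eqF//; lra.
  apply: mulr_ge0; last by rewrite subr_ge0.
  have q0 : 0 <= 2 * m%:R + 1 :> R by lra.
  by apply: divr_ge0; [rewrite mulr_ge0// ltW | rewrite mulr_ge0// ltW].
have l := cos_primitive_pihalf_decr (R := R) (2 * m).-1.
have h := cos_primitive_pihalf_mul (R := R) (2 * m).-1.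
rewrite prednK in l h; last by lia.
have : cos_primitive (2 * m) (pi / 2) ^+ 2 <= pi / (2 * (2 * m)%N%:R) :> R.
  by rewrite -h expr2 ler_pM2r.
rewrite e natrM ler_pdivlMr; last by lra.
move=> h'; rewrite -subr_ge0.
have -> : 1 - central_ratio m ^+ 2 * (pi * m%:R) =
  (pi - (central_ratio m * (pi / 2)) ^+ 2 * (2 * (2 * m%:R))) / pi :> R.
  by move: (pi : R) p0 => q q0; field; rewrite gt_eqF.
by apply: divr_ge0; rewrite ?subr_ge0//; lra.
Qed.

(** * The number of critical points *)

Lemma card_ord_lt_half (n w : nat) : odd w -> (w <= n)%N ->
  #|[set k : 'I_n | (0 < k)%N && (2 * k < w)%N]%SET| = w./2.
Proof.
move=> ow wn; rewrite cardsE -sum1_card big_mkcond /=.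
rewrite -(big_mkord xpredT (fun k => if (0 < k)%N && (2 * k < w)%N then 1%N else 0%N)).
rewrite (big_cat_nat (n := (w./2).+1)) //=; last by lia.
rewrite [X in (_ + X)%N]big_nat_cond [X in (_ + X)%N]big1 ?addn0; last first.
  by move=> i; rewrite andbT => /andP[h _]; case: ifP => //; lia.
rewrite big_nat_recl//= add0n big_nat_cond (eq_bigr (fun=> 1%N)); last first.
  by move=> i; rewrite andbT => /andP[_ h]; case: ifP => //; lia.
by rewrite -big_nat_cond sum_nat_const_nat muln1 subn0.
Qed.

(** With [j] clockwise edges the winding sum is [2 (m - j) + 1], which leaves [m - j] winding
    numbers. *)
Lemma card_closed_polygons_sum (m : nat) :
  #|closed_polygons (2 * m + 1)| =
  (\sum_(j < m.+1) 'C(2 * m + 1, j) * (m - j))%N.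
Proof.
set n := (2 * m + 1)%N.
transitivity (\sum_(A : {set 'I_n} | (#|A| < m.+1)%N) (m - #|A|))%N.
  rewrite /closed_polygons cardsE -sum1_card.
  rewrite (eq_bigl (fun x : {set 'I_n} * 'I_n => (#|x.1| < m.+1)%N &&
    ((0 < x.2)%N && (2 * x.2 < winding_sum x.1)%N))); last first.
    by move=> x; rewrite unfold_in /=; congr (_ && _); rewrite /n; lia.
  rewrite -(pair_big_dep (fun A : {set 'I_n} => #|A| < m.+1)%N
    (fun A (k : 'I_n) => (0 < k)%N && (2 * k < winding_sum A)%N) (fun _ _ => 1%N)) /=.
  apply: eq_bigr => A hA.
  have := card_ord_lt_half n (winding_sum A); rewrite cardsE -sum1_card => ->.
  1-3: by move: hA; rewrite /winding_sum /n; move: #|A| => c; lia.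
rewrite (partition_big (fun A : {set 'I_n} => inord #|A| : 'I_m.+1) xpredT) //=.
apply: eq_bigr => j _.
rewrite (eq_bigl (fun A : {set 'I_n} => #|A| == j)); last first.
  move=> A; apply/andP/eqP => [[h /eqP <-]|->]; first by rewrite inordK.
  by rewrite ltn_ord; split=> //; apply/eqP/val_inj; rewrite /= inordK.
rewrite (eq_bigr (fun=> (m - j)%N)); last by move=> A /eqP ->.
rewrite sum_nat_const; congr (_ * _)%N.
by have := card_draws 'I_n j; rewrite cardsE card_ord => <-.
Qed.

(** The symmetry of the binomial coefficients splits the full sum [2 ^ (2 m + 1)] into two equal
    halves. *)
Lemma sum_bin_half (m : nat) : (\sum_(j < m.+1) 'C(2 * m + 1, j) = 4 ^ m)%N.
Proof.
have h : (\sum_(j < m.+1 + m.+1) 'C(2 * m + 1, j) = 2 * 4 ^ m)%N.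
  have -> : (m.+1 + m.+1 = (2 * m + 1).+1)%N by lia.
  have := expnDn 1 1 (2 * m + 1); rewrite (_ : (1 + 1 = 2)%N)// => e.
  rewrite (eq_bigr (fun i : 'I_(2 * m + 1).+1 =>
    'C(2 * m + 1, i) * (1 ^ (2 * m + 1 - i) * 1 ^ i))%N); last first.
    by move=> i _; rewrite !exp1n !muln1.
  by rewrite -e addn1 expnS (expnM 2 2).
move: h; rewrite big_split_ord /=.
rewrite [X in (_ + X)%N](reindex_inj rev_ord_inj) /=.
rewrite [X in (_ + X)%N](eq_bigr (fun i : 'I_m.+1 => 'C(2 * m + 1, i))); last first.
  move=> i _; rewrite -bin_sub; last by have := ltn_ord i; lia.
  by congr 'C(_, _); have := ltn_ord i; lia.
lia.
Qed.

(** Telescopes: [C(n, j) (n - 2 j) = n (C(n-1, j) - C(n-1, j-1))]. *)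
Lemma sum_bin_linear {R : realType} (n p : nat) : (p < n)%N ->
  \sum_(j < p.+1) 'C(n, j)%:R * (n%:R - 2 * j%:R) = n%:R * 'C(n.-1, p)%:R :> R.
Proof.
elim: p => [|p IH] pn; first by rewrite big_ord1 !bin0 mulr0 subr0 mulrC.
rewrite big_ord_recr /= IH; last exact: ltnW.
have h1 : n%:R * 'C(n.-1, p)%:R = p.+1%:R * 'C(n, p.+1)%:R :> R.
  by rewrite -!natrM mul_bin_diag.
have h2 : n%:R * 'C(n.-1, p.+1)%:R = (n%:R - p.+1%:R) * 'C(n, p.+1)%:R :> R.
  by rewrite -natrB 1?ltnW// -!natrM mul_bin_down.
by rewrite h1 h2; ring.
Qed.

Lemma card_closed_polygons {R : realType} (m : nat) : (0 < m)%N ->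
  #|closed_polygons (2 * m + 1)|%:R =
  2 ^+ (2 * m - 1) * (-1 + (2 * m + 1)%N%:R * central_ratio m) :> R.
Proof.
move=> m0; rewrite card_closed_polygons_sum /central_ratio.
have h4 : (4 : R) ^+ m = 2 * 2 ^+ (2 * m - 1).
  rewrite -exprS (_ : (2 * m - 1).+1 = 2 * m)%N; last by lia.
  by rewrite exprM; congr (_ ^+ _); rewrite -natrX.
have h := @sum_bin_linear R (2 * m + 1) m ltac:(lia).
have n1 : ((2 * m + 1).-1 = 2 * m)%N by lia.
rewrite n1 in h.
have hb : \sum_(j < m.+1) 'C(2 * m + 1, j)%:R = (4 : R) ^+ m.
  by rewrite -natr_sum sum_bin_half natrX.
have e : 2 * (\sum_(j < m.+1) 'C(2 * m + 1, j) * (m - j))%N%:R + 4 ^+ m =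
    (2 * m + 1)%N%:R * 'C(2 * m, m)%:R :> R.
  rewrite -h -hb natr_sum mulr_sumr -big_split /=; apply: eq_bigr => j _.
  rewrite natrM natrB; last by have := ltn_ord j; lia.
  by rewrite natrD natrM; ring.
have n4 : (4 : R) ^+ m != 0 by rewrite expf_neq0// pnatr_eq0.
have n2 : (2 : R) ^+ (2 * m - 1) != 0 by rewrite expf_neq0// pnatr_eq0.
apply: (mulfI (_ : 2 != 0 :> R)); first by rewrite pnatr_eq0.
rewrite mulrA mulrDr -h4 mulrN1.
have -> : (4 : R) ^+ m * ((2 * m + 1)%N%:R * ('C(2 * m, m)%:R / 4 ^+ m)) =
  (2 * m + 1)%N%:R * 'C(2 * m, m)%:R by field.
by rewrite -e; ring.
Qed.

Lemma critical_count_asymp (R : realType) :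
  asymp_equiv \oo
    (fun m : nat => (setcard (Un R (2 * m + 1)%N))%:R : R)
    (fun m : nat => 2 ^+ (2 * m - 1)%N *
       (-1 + (2 * m + 1)%N%:R / Num.sqrt (pi * m%:R))).
Proof.
rewrite /asymp_equiv; apply/cvgrPdist_le => e e0.
near=> m.
(* As [pi < 4], this gives [sqrt (pi m) <= m], which bounds the denominator [N - s] below by
   [m + 1]. *)
have m4 : (4 <= m)%N by near: m; exact: nbhs_infty_ge.
have me : (m.+1%:R)^-1 < e by near: m; exact: near_infty_natSinv_lt (PosNum e0).
rewrite card_Un; [|by lia|by lia].
rewrite card_closed_polygons; last by lia.
have n2 : (2 : R) ^+ (2 * m - 1) != 0 by rewrite expf_neq0// pnatr_eq0.
rewrite -mulf_div divff// mul1r.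
have /andP[lo up] := @central_ratio_bounds R m ltac:(lia).
set c := central_ratio m in lo up *; set s := Num.sqrt _.
have p0 : 0 < pi :> R := pi_gt0 R.
have p4 : pi < 4 :> R by have := @pihalf_lt2 R; lra.
have mR : 4 <= m%:R :> R by rewrite ler_nat.
have s0 : 0 < s by rewrite sqrtr_gt0 mulr_gt0//; lra.
have s2 : s ^+ 2 = pi * m%:R by rewrite sqr_sqrtr// mulr_ge0//; lra.
have sm : s <= m%:R by nra.
have c0 : 0 < c by rewrite divr_gt0 ?exprn_gt0// ltr0n bin_gt0; lia.
set N := (2 * m + 1)%N%:R in lo *.
have NE : N = 2 * m%:R + 1 by rewrite /N natrD natrM.
rewrite -s2 -exprMn in lo up.
have cs0 : 0 < c * s by rewrite mulr_gt0.
have cs1 : c * s <= 1 by rewrite -(ler_pXn2r (n := 2)) ?nnegrE ?expr1n// ltW.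
(* The Wallis bound concerns the square, but [c * s <= 1] makes the square the smaller of the
   two. *)
have csN : 1 - N^-1 <= c * s.
  by apply: (le_trans lo); rewrite expr2 ler_piMr// ltW.
have N0 : 0 < N by lra.
have d0 : 0 < N - s by lra.
have -> : 1 - (-1 + N * c) / (-1 + N / s) = N * (1 - c * s) / (N - s).
  have ? : s != 0 by rewrite gt_eqF.
  have ? : N - s != 0 by rewrite gt_eqF.
  by field; rewrite -NE; apply/andP.
rewrite ger0_norm; last by rewrite divr_ge0 ?mulr_ge0//; lra.
apply: (le_trans _ (ltW me)).
rewrite ler_pdivrMr// [leRHS]mulrC ler_pdivlMr ?ltr0n//.
have h : N * (1 - c * s) <= 1.
  by rewrite -(ler_pM2l (x := N^-1)) ?invr_gt0// mulrA mulVf ?gt_eqF// mul1r mulr1; lra.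
have m1 : m.+1%:R = m%:R + 1 :> R by rewrite -natr1.
have m1' : m.+1%:R <= N - s by rewrite m1; lra.
by apply: (le_trans _ m1'); rewrite mulrC ler_piMr.
Unshelve. all: by end_near. Qed.

(** * Counting reduced fractions with odd denominator *)

Definition odd_pairs (n : nat) : {set 'I_n.+1 * 'I_n.+1} :=
  [set x : 'I_n.+1 * 'I_n.+1 | [&& odd x.2, (0 < x.1)%N & (2 * x.1 < x.2)%N]].

(** Matched with critical values only for odd [n], but defined for all [n], since the gcd relation
    visits [n %/ d] of either parity. *)
Definition coprime_pairs (n : nat) : {set 'I_n.+1 * 'I_n.+1} :=
  [set x in odd_pairs n | coprime x.1 x.2].


(** An odd [s] admits [(s - 1) / 2] numerators, so with [u = uphalf n] odd denominators the count is
    [0 + 1 + ... + (u - 1)]. *)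
Lemma card_odd_pairs (n : nat) :
  (2 * #|odd_pairs n| + uphalf n = uphalf n * uphalf n)%N.
Proof.
have -> : #|odd_pairs n| = (\sum_(s < n.+1 | odd s) s./2)%N.
  rewrite -sum1_card (eq_bigl (fun x : 'I_n.+1 * 'I_n.+1 =>
    true && [&& odd x.2, (0 < x.1)%N & (2 * x.1 < x.2)%N])); last first.
    by move=> x; rewrite inE.
  rewrite -(pair_big_dep xpredT (fun k s : 'I_n.+1 => [&& odd s, (0 < k)%N & (2 * k < s)%N])
    (fun _ _ => 1%N)) /=.
  rewrite (exchange_big_dep (fun s : 'I_n.+1 => odd s)) /=; last by move=> k s _ /andP[].
  apply: eq_bigr => s os.
  rewrite (eq_bigl (fun k : 'I_n.+1 => (0 < k)%N && (2 * k < s)%N)); last first.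
    by move=> k; rewrite os.
  have := card_ord_lt_half n.+1 s os (ltnW (ltn_ord s)).
  by rewrite cardsE -sum1_card.
elim: n => [|n IH]; first by rewrite big_mkcond big_ord1.
rewrite big_mkcond big_ord_recr -big_mkcond /=.
move: IH; move: (\sum_(s < n.+1 | _) _)%N => S.
have [on|on] := boolP (odd n) => /=.
  have -> : (n./2).+1 = uphalf n by lia.
  by rewrite addn0.
have -> : uphalf n = n./2 by lia.
lia.
Qed.

(** Multiplication by [d] is a bijection from the coprime pairs up to [n %/ d] onto the pairs of gcd
    [d]; [d] is odd as a divisor of the denominator. *)
Lemma card_odd_pairs_gcd (n : nat) :
  #|odd_pairs n| = (\sum_(d < n.+1 | odd d) #|coprime_pairs (n %/ d)|)%N.
Proof.
rewrite -sum1_card (partition_big (fun x : 'I_n.+1 * 'I_n.+1 =>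
  inord (gcdn x.1 x.2) : 'I_n.+1) (fun d : 'I_n.+1 => odd d)) /=; last first.
  move=> x; rewrite inE => /and3P[sodd x0 _]; rewrite inordK.
    by apply: dvdn_odd sodd; exact: dvdn_gcdr.
  by rewrite ltnS (leq_trans (dvdn_leq x0 (dvdn_gcdl _ _)))// -ltnS.
apply: eq_bigr => d od.
have d0 : (0 < d)%N by exact: odd_gt0.
pose f (y : 'I_(n %/ d).+1 * 'I_(n %/ d).+1) : 'I_n.+1 * 'I_n.+1 :=
  (inord (d * y.1), inord (d * y.2)).
have dn (k : 'I_(n %/ d).+1) : (d * k < n.+1)%N.
  by rewrite ltnS mulnC -leq_divRL// -ltnS.
have f1 y : (f y).1 = (d * y.1)%N :> nat by rewrite inordK.
have f2 y : (f y).2 = (d * y.2)%N :> nat by rewrite inordK.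
have fi : injective f.
  move=> y z e; have := f1 y; have := f2 y; rewrite e f1 f2 => /eqP h2 /eqP h1.
  move: h1 h2; rewrite !eqn_pmul2l// => /eqP/val_inj h1 /eqP/val_inj h2.
  by case: y z h1 h2 {e} => [y1 y2] [z1 z2] /= -> ->.
rewrite -(card_imset _ fi) sum1dep_card; apply: eq_card => x.
rewrite [in LHS]inE; apply/idP/imsetP.
  rewrite inE => /andP[/and3P[sodd x0 x12] /eqP gd].
  have {}gd : gcdn x.1 x.2 = d.
    rewrite -gd inordK//.
    by rewrite ltnS (leq_trans (dvdn_leq x0 (dvdn_gcdl _ _)))// -ltnS.
  have d1 : (d %| x.1)%N by rewrite -gd dvdn_gcdl.
  have d2 : (d %| x.2)%N by rewrite -gd dvdn_gcdr.
  have lt (k : 'I_n.+1) : (k %/ d < (n %/ d).+1)%N by rewrite ltnS leq_div2r// -ltnS.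
  have e1 : (d * (x.1 %/ d) = x.1)%N by rewrite mulnC divnK.
  have e2 : (d * (x.2 %/ d) = x.2)%N by rewrite mulnC divnK.
  exists (Ordinal (lt x.1), Ordinal (lt x.2)).
    rewrite !inE /=; apply/andP; split; last first.
      by rewrite /coprime -(eqn_pmul2l d0) muln1 muln_gcdr e1 e2 gd.
    apply/and3P; split.
    - by move: sodd; rewrite -{1}e2 oddM => /andP[].
    - by rewrite divn_gt0// -gd dvdn_leq// dvdn_gcdl.
    - by rewrite -(ltn_pmul2l d0) mulnCA e1 e2.
  rewrite [LHS]surjective_pairing /f /= e1 e2.
  by congr (_, _); rewrite inord_val.
move=> [y]; rewrite !inE => /andP[/and3P[sodd y0 y12] cy] ->.
rewrite f1 f2 oddM od sodd muln_gt0 d0 y0 mulnCA ltn_pmul2l// y12 /=.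
apply/eqP/val_inj; rewrite /= -muln_gcdr (eqP cy) muln1 inordK//.
Qed.

(** * The sum of the inverse squares of odd numbers *)

Lemma sin_le_id {R : realType} (x : R) : 0 <= x -> sin x <= x.
Proof.
move=> x0; have cs : {within `[0, x], continuous (@sin R)}.
  by apply/continuous_subspaceT => y; exact: continuous_sin.
have [c _] := MVT_segment x0 (fun y _ => is_derive_sin y) cs.
by rewrite sin0 !subr0 => ->; rewrite ler_piMl// cos_le1.
Qed.

Lemma mul_cos_le_sin {R : realType} (x : R) : 0 <= x <= pi -> x * cos x <= sin x.
Proof.
move=> /andP[x0 xp]; pose f : R -> R := @sin R - (id * @cos R).
have df (y : R) : is_derive y 1 f (y * sin y).
  have d1 := @is_deriveM R R id (@cos R) y 1 _ _ (is_derive_id y 1) (is_derive_cos y).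
  have d2 := @is_deriveB R R R (@sin R) _ y 1 _ _ (is_derive_sin y) d1.
  by apply: (is_derive_eq d2); rewrite /GRing.scale /=; ring.
have cf : {within `[0, x], continuous f}.
  apply/continuous_subspaceT => y.
  by apply/differentiable_continuous/derivable1_diffP; have [] := df y.
have [c] := MVT_segment x0 (fun y _ => df y) cf.
rewrite in_itv /= => /andP[c0 cx]; rewrite /f !fctE sin0 mul0r !subr0 => h.
rewrite -subr_ge0 h !mulr_ge0// sin_ge0_pi// c0 /=.
exact: le_trans xp.
Qed.

(** This is [sin x <= x <= tan x], the left-hand term being [cot^2 x]. *)
Lemma inv_sqr_sin_bounds {R : realType} (x : R) : 0 < x < pi / 2 ->
  (sin x ^+ 2)^-1 - 1 <= (x ^+ 2)^-1 <= (sin x ^+ 2)^-1.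
Proof.
move=> /[dup] x02 /andP[x0 x2]; have p0 : 0 < pi :> R := pi_gt0 R.
have s0 : 0 < sin x by exact: sin_gt0_pihalf.
have c0 : 0 < cos x by apply: cos_gt0_pihalf; apply/andP; split; lra.
have s1 := sin_le_id x (ltW x0).
have s2 : x * cos x <= sin x by apply: mul_cos_le_sin; apply/andP; split; lra.
apply/andP; split; last first.
  by rewrite lef_pV2 ?posrE ?exprn_gt0// ler_pXn2r// nnegrE ltW.
have -> : (sin x ^+ 2)^-1 - 1 = cos x ^+ 2 / sin x ^+ 2.
  by rewrite cos2sin2 mulrBl mul1r divff// expf_neq0// gt_eqF.
rewrite ler_pdivrMr ?exprn_gt0// mulrC ler_pdivlMr ?exprn_gt0//.
rewrite mulrC -exprMn ler_pXn2r// nnegrE ?ltW// mulr_gt0//.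
Qed.

(** Angle doubling: [1 / sin^2 y + 1 / cos^2 y = 4 / sin^2 (2 y)], so pairing [y] with [pi / 2 - y]
    gives 4 times the previous sum. *)
Lemma sum_inv_sqr_sin {R : realType} (n : nat) :
  \sum_(k < 2 ^ n) (sin ((2 * k + 1)%:R * (pi / 2 ^+ n.+2)) ^+ 2)^-1 =
  2 * 4 ^+ n :> R.
Proof.
elim: n => [|n IH].
  rewrite expn0 big_ord1 expr0 mulr1 mul1r.
  have -> : sin (pi / 2 ^+ 2) ^+ 2 = 2^-1 :> R.
    have := cos_mulr2n (pi / 2 ^+ 2 : R).
    have -> : (pi / 2 ^+ 2) *+ 2 = pi / 2 :> R.
      by rewrite -(mulr_natr (pi / 2 ^+ 2)) expr2 invfM mulrA divfK// pnatr_eq0.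
    by rewrite cos_pihalf sin2cos2; lra.
  by rewrite invrK.
have -> : (2 ^ n.+1 = 2 ^ n + 2 ^ n)%N by rewrite expnS mul2n addnn.
rewrite big_split_ord /= [X in _ + X](reindex_inj rev_ord_inj) /= -big_split /=.
have -> : 2 * 4 ^+ n.+1 = 4 * (2 * 4 ^+ n) :> R by rewrite exprS; ring.
rewrite -IH mulr_sumr; apply: eq_bigr => k _.
set y := (2 * k + 1)%N%:R * (pi / 2 ^+ n.+3).
have q0 : (2 : R) ^+ n.+2 != 0 by rewrite expf_neq0// pnatr_eq0.
have p0 : 0 < pi :> R := pi_gt0 R.
have q1 : 0 < (2 : R) ^+ n.+2 by rewrite exprn_gt0.
have -> : (2 * k + 1)%N%:R * (pi / 2 ^+ n.+2) = y *+ 2 :> R.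
  by rewrite /y (exprS _ n.+2) -mulr_natr; move: (2 ^+ n.+2) q0 (pi : R) => q q0 p; field.
have kn : ((2 * k).+1 <= 2 ^ n.+2)%N.
  by have := ltn_ord k; rewrite !expnS; lia.
have -> : (2 * (2 ^ n + (2 ^ n - k.+1)) + 1)%N%:R * (pi / 2 ^+ n.+3) = pi / 2 - y :> R.
  have -> : (2 * (2 ^ n + (2 ^ n - k.+1)) + 1 = 2 ^ n.+2 - (2 * k + 1))%N.
    by have := ltn_ord k; rewrite !expnS; lia.
  rewrite natrB ?addn1// natrX /y (exprS _ n.+2) -[(2 * k).+1]addn1.
  move: (2 ^+ n.+2) q0 (pi : R) (_%:R : R) => q q0 p r.
  by field.
have -> : sin (pi / 2 - y) = cos y by rewrite sinB cos_pihalf sin_pihalf mul1r mul0r subr0.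
have y0 : 0 < y by rewrite /y mulr_gt0 ?divr_gt0 ?exprn_gt0// ltr0n addn1.
have y1 : y < pi / 2.
  rewrite /y mulrA ltr_pdivrMr ?exprn_gt0// (exprS _ n.+2) mulrA divfK ?pnatr_eq0//.
  rewrite mulrC ltr_pM2l// -natrX ltr_nat addn1.
  have := ltn_ord k; rewrite !expnS; lia.
have s0 : sin y != 0 by rewrite gt_eqF// sin_gt0_pihalf// y0.
have c0 : cos y != 0 by rewrite gt_eqF// cos_gt0_pihalf//; apply/andP; split; lra.
rewrite sin_mulr2n -mulr_natr.
transitivity ((cos y ^+ 2 + sin y ^+ 2) / (sin y ^+ 2 * cos y ^+ 2)).
  by field; rewrite s0 c0.
by rewrite cos2Dsin2; field; rewrite s0 c0.
Qed.

Definition odd_zeta2 {R : realType} (N : nat) : R :=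
  \sum_(j < N) (((2 * j + 1)%N%:R) ^+ 2)^-1.

Lemma odd_zeta2_pow2 {R : realType} (n : nat) :
  pi ^+ 2 / 8 * (1 - (2 ^+ n)^-1) <= (odd_zeta2 (2 ^ n) : R) <= pi ^+ 2 / 8.
Proof.
have p0 : 0 < pi :> R := pi_gt0 R.
have q0 : 0 < (2 : R) ^+ n by rewrite exprn_gt0.
set h : R := pi / 2 ^+ n.+2.
have h0 : 0 < h by rewrite divr_gt0// exprn_gt0.
have itv (j : 'I_(2 ^ n)) : 0 < (2 * j + 1)%N%:R * h < pi / 2.
  rewrite mulr_gt0 ?ltr0n ?addn1//= /h mulrA ltr_pdivrMr ?exprn_gt0//.
  rewrite exprS mulrA divfK ?pnatr_eq0// mulrC ltr_pM2l// -natrX ltr_nat.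
  by have := ltn_ord j; rewrite expnS; lia.
have S := @sum_inv_sqr_sin R n; rewrite -/h in S.
have e : odd_zeta2 (2 ^ n) = h ^+ 2 * \sum_(j < 2 ^ n) (((2 * j + 1)%N%:R * h) ^+ 2)^-1.
  rewrite /odd_zeta2 mulr_sumr; apply: eq_bigr => j _.
  have h20 : h ^+ 2 != 0 by rewrite expf_neq0// gt_eqF.
  move: ((2 * j + 1)%N%:R : R) (h) h20 => a b b0.
  by rewrite [in RHS]exprMn [in RHS]invfM [RHS]mulrCA mulfV// mulr1.
have h2 : h ^+ 2 * (2 * 4 ^+ n) = pi ^+ 2 / 8.
  have e4 : (4 : R) ^+ n = (2 ^+ n) ^+ 2 by rewrite -exprM mulnC exprM; congr (_ ^+ _); ring.
  rewrite /h e4 !exprS; move: (2 ^+ n) q0 (pi : R) => q q0 p.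
  by field; rewrite gt_eqF.
apply/andP; split.
  rewrite e -h2 -mulrA ler_pM2l ?exprn_gt0//.
  (* Subtracting 2 per term instead of the available 1 gives exactly the relative error
     [2 ^ (- n)]. *)
  have -> : 2 * 4 ^+ n * (1 - (2 ^+ n)^-1) =
      \sum_(j < 2 ^ n) ((sin ((2 * j + 1)%:R * h) ^+ 2)^-1 - 2) :> R.
    rewrite sumrB S sumr_const card_ord.
    have e4 : (4 : R) ^+ n = 2 ^+ n * 2 ^+ n by rewrite -exprMn; congr (_ ^+ _); ring.
    rewrite -[2 *+ _]mulr_natr natrX e4; move: (2 ^+ n) q0 => q q0.
    by field; rewrite gt_eqF.
  apply: ler_sum => j _; have /andP[l _] := inv_sqr_sin_bounds _ (itv j); lra.
rewrite e -h2 ler_pM2l ?exprn_gt0// -S; apply: ler_sum => j _.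
by have /andP[_] := inv_sqr_sin_bounds _ (itv j).
Qed.

Lemma ler_odd_zeta2 {R : realType} (M N : nat) : (M <= N)%N ->
  odd_zeta2 M <= odd_zeta2 N :> R.
Proof.
move=> MN; rewrite /odd_zeta2 -!(big_mkord xpredT (fun j => (((2 * j + 1)%N%:R) ^+ 2)^-1)).
rewrite [leRHS](big_cat_nat (n := M))//= lerDl sumr_ge0// => j _; rewrite invr_ge0 sqr_ge0.
Qed.

Lemma odd_zeta2_le {R : realType} (N : nat) : odd_zeta2 N <= pi ^+ 2 / 8 :> R.
Proof.
apply: le_trans (ler_odd_zeta2 N (2 ^ N) _) _; first by rewrite ltnW// ltn_expl.
by have /andP[] := @odd_zeta2_pow2 R N.
Qed.

Lemma odd_zeta2_near {R : realType} (d : R) : 0 < d ->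
  exists N, pi ^+ 2 / 8 - d <= odd_zeta2 N.
Proof.
move=> d0; have p0 : 0 < pi :> R := pi_gt0 R.
have p2 : 0 < pi ^+ 2 / 8 :> R by rewrite divr_gt0// exprn_gt0.
have [N hN] : exists N : nat, pi ^+ 2 / 8 / d <= N%:R :> R.
  exists (Num.truncn (pi ^+ 2 / 8 / d)).+1; exact: ltW (truncnS_gt _).
exists (2 ^ N)%N; have /andP[l _] := @odd_zeta2_pow2 R N.
apply: le_trans l; rewrite mulrBr mulr1 lerD2l lerN2.
rewrite ler_pdivrMr ?exprn_gt0//; move: hN; rewrite ler_pdivrMr// => hN.
apply: (le_trans hN); rewrite mulrC ler_pM2l//.
by rewrite -natrX ler_nat ltnW// ltn_expl.
Qed.

Lemma sum_odd_ord {V : nmodType} (n : nat) (F : nat -> V) :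
  \sum_(d < n.+1 | odd d) F d = \sum_(j < uphalf n) F (2 * j + 1)%N.
Proof.
elim: n => [|n IH]; first by rewrite big_mkcond big_ord1 big_ord0.
rewrite big_mkcond big_ord_recr -big_mkcond /= IH.
have [on|on] := boolP (odd n) => /=.
  by rewrite addr0 (_ : n./2.+1 = uphalf n)//; lia.
rewrite big_ord_recr /= (_ : uphalf n = n./2); last by lia.
by congr (_ + F _); lia.
Qed.

(** The rounding loses less than 1, and [n / d <= n], so the error of the square is linear in [n]
    uniformly in [d]. *)
Lemma divn_sqr_bounds {R : realType} (n d : nat) : (0 < d)%N ->
  n%:R ^+ 2 * (d%:R ^+ 2)^-1 - 2 * n%:R <= ((n %/ d)%N%:R : R) ^+ 2 <=
  n%:R ^+ 2 * (d%:R ^+ 2)^-1.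
Proof.
move=> d0; have d0R : 0 < d%:R :> R by rewrite ltr0n.
have d1R : 1 <= d%:R :> R by rewrite ler1n.
rewrite -exprVn -exprMn; set x := n%:R / d%:R.
have f0 : 0 <= (n %/ d)%N%:R :> R by rewrite ler0n.
have x0 : 0 <= x by rewrite divr_ge0.
have fx : (n %/ d)%N%:R <= x by rewrite ler_pdivlMr// -natrM ler_nat leq_divM.
have xf : x <= (n %/ d)%N%:R + 1.
  by rewrite ler_pdivrMr// natr1 -natrM ler_nat ltnW// ltn_ceil.
have xn : x <= n%:R by rewrite ler_pdivrMr// ler_peMr.
apply/andP; split; nra.
Qed.

Lemma sum_divn_sqr {R : realType} (d : R) : 0 < d -> exists K : R, forall n : nat,
  `|\sum_(j < uphalf n) ((n %/ (2 * j + 1))%N%:R) ^+ 2 - n%:R ^+ 2 * (pi ^+ 2 / 8)|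
  <= d * n%:R ^+ 2 + K.
Proof.
move=> d0; have d20 : 0 < d / 2 by lra.
have [N hN] := odd_zeta2_near (d / 2) d20.
(* Only [N] terms are compared from below, at a cost of [2 n N]; this constant absorbs it together
   with [d / 2 * n ^ 2]. *)
exists (2 * N%:R ^+ 2 / d) => n.
set S := \sum_(j < _) _.
have up : S <= n%:R ^+ 2 * (pi ^+ 2 / 8).
  apply: (@le_trans _ _ (n%:R ^+ 2 * odd_zeta2 (uphalf n))); last first.
    by rewrite ler_wpM2l ?sqr_ge0// odd_zeta2_le.
  rewrite /odd_zeta2 mulr_sumr; apply: ler_sum => j _.
  by have /andP[] := @divn_sqr_bounds R n (2 * j + 1) ltac:(by rewrite addn1).
have lo : n%:R ^+ 2 * odd_zeta2 N - 2 * n%:R * N%:R <= S.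
  apply: (@le_trans _ _ (\sum_(j < N) ((n %/ (2 * j + 1))%N%:R) ^+ 2)).
    rewrite /odd_zeta2 mulr_sumr [X in _ - X](_ : _ = \sum_(j < N) (2 * n%:R)); last first.
      by rewrite sumr_const card_ord mulr_natr.
    rewrite -sumrB; apply: ler_sum => j _.
    by have /andP[] := @divn_sqr_bounds R n (2 * j + 1) ltac:(by rewrite addn1).
  rewrite /S -!(big_mkord xpredT (fun j => ((n %/ (2 * j + 1))%N%:R : R) ^+ 2)).
  have [NM|MN] := leqP N (uphalf n).
    by rewrite [leRHS](big_cat_nat (n := N))//= lerDl sumr_ge0// => j _; rewrite sqr_ge0.
  (* For [j >= uphalf n] the divisor exceeds [n] and the quotient is 0. *)
  rewrite (big_cat_nat (n := uphalf n))//=; last exact: ltnW.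
  rewrite [X in _ + X]big_nat_cond [X in _ + X]big1 ?addr0// => j.
  rewrite andbT => /andP[hj _]; rewrite divn_small ?expr0n//.
  by lia.
have h3 : n%:R ^+ 2 * (pi ^+ 2 / 8 - d / 2) <= n%:R ^+ 2 * odd_zeta2 N.
  by rewrite ler_wpM2l// sqr_ge0.
have h4 : 2 * n%:R * N%:R <= d / 2 * n%:R ^+ 2 + 2 * N%:R ^+ 2 / d.
  rewrite -subr_ge0.
  have -> : d / 2 * n%:R ^+ 2 + 2 * N%:R ^+ 2 / d - 2 * n%:R * N%:R =
    (d * n%:R - 2 * N%:R) ^+ 2 / (2 * d) :> R by field; rewrite gt_eqF.
  by rewrite divr_ge0 ?sqr_ge0//; lra.
have dn : 0 <= d * n%:R ^+ 2 by rewrite mulr_ge0 ?sqr_ge0// ltW.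
have K0 : 0 <= 2 * N%:R ^+ 2 / d by rewrite divr_ge0 ?mulr_ge0 ?sqr_ge0// ltW.
rewrite ler_norml; apply/andP; split; nra.
Qed.

(** * The number of critical values *)

(** The additive constant replaces a restriction to large [n]: the bound must also apply at
    [n %/ (2 * j + 1)], however small. Holding for every [c > 0], it expresses [E n = o(n^2)]. *)
Definition quadratically_bounded {R : realType} (E : nat -> R) (c : R) : Prop :=
  exists K : R, forall n : nat, `|E n| <= c * n%:R ^+ 2 + K.

Lemma linear_le_quadratic {R : realType} (d K x : R) : 0 < d ->
  K * x <= d * x ^+ 2 + K ^+ 2 / (4 * d).
Proof.
move=> d0; rewrite -subr_ge0.
have -> : d * x ^+ 2 + K ^+ 2 / (4 * d) - K * x = (2 * d * x - K) ^+ 2 / (4 * d).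
  by field; rewrite gt_eqF.
by rewrite divr_ge0 ?sqr_ge0//; lra.
Qed.

(* The terms [j >= 1] of the sum carry the total weight
   [1/9 + 1/25 + ... = pi^2/8 - 1 < 1], so solving the relation for [E n]
   improves any quadratic bound by a constant factor. *)
Lemma quadratically_bounded_contract {R : realType} (E : nat -> R) (c : R) :
  (forall d, 0 < d -> quadratically_bounded
     (fun n => \sum_(j < uphalf n) E (n %/ (2 * j + 1))%N) d) ->
  0 < c -> quadratically_bounded E c ->
  quadratically_bounded E (pi ^+ 2 / 16 * c).
Proof.
move=> H c0 [K hK].
have p0 : 0 < pi :> R := pi_gt0 R.
have p4 : pi < 4 :> R by have := @pihalf_lt2 R; lra.
set q : R := pi ^+ 2 / 8 - 1.
have q1 : q < 1 by rewrite /q ltrBlDr ltr_pdivrMr//; nra.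
have E0 := hK 0%N; rewrite expr0n mulr0 add0r in E0.
have K0 : 0 <= K := le_trans (normr_ge0 _) E0.
(* The gap [c (1 - q)] is halved, and the half shared by the error of the relation and the linear
   term [K n]. What results is [c (1 + q) / 2 = pi^2 / 16 * c]. *)
set d := c * (1 - q) / 4.
have d0 : 0 < d by rewrite /d divr_gt0// mulr_gt0// subr_gt0.
have [L hL] := H d d0.
have L0 : 0 <= L.
  by have := hL 0%N; rewrite big_ord0 normr0 expr0n mulr0 add0r.
have KK0 : 0 <= K ^+ 2 / (4 * d) by rewrite divr_ge0 ?sqr_ge0//; lra.
exists (L + K + K ^+ 2 / (4 * d)) => -[|n].
  by rewrite expr0n mulr0 add0r; lra.
have := hL n.+1; set M := n./2; rewrite (_ : uphalf n.+1 = M.+1)//.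
rewrite big_ord_recl muln0 add0n divn1; set T := \sum_(j < M) _ => h1.
have hT : `|T| <= c * n.+1%:R ^+ 2 * q + K * n.+1%:R.
  apply: le_trans (ler_norm_sum _ _ _) _.
  apply: (@le_trans _ _ (\sum_(j < M)
     (c * n.+1%:R ^+ 2 * (((2 * lift ord0 j + 1)%N%:R) ^+ 2)^-1 + K))).
    apply: ler_sum => j _; apply: le_trans (hK _) _.
    rewrite lerD2r -mulrA; apply: ler_wpM2l; first exact: ltW.
    by have /andP[] := @divn_sqr_bounds R n.+1 (2 * lift ord0 j + 1) ltac:(by rewrite addn1).
  rewrite big_split /= -mulr_sumr lerD//.
    apply: ler_wpM2l; first by rewrite mulr_ge0 ?sqr_ge0// ltW.
    rewrite /q lerBrDl.
    have := @odd_zeta2_le R M.+1.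
    by rewrite /odd_zeta2 big_ord_recl muln0 add0n expr1n invr1.
  rewrite sumr_const card_ord -(mulr_natr K) ler_wpM2l// ler_nat /M; lia.
have h2 := @linear_le_quadratic R d K n.+1%:R d0.
have h3 : `|E n.+1| <= `|E n.+1 + T| + `|T|.
  by rewrite -[X in `|X| <= _](addrK T) ler_normB.
have dE : d + d + c * q = pi ^+ 2 / 16 * c by rewrite /d /q; field.
have x0 : 0 <= n.+1%:R ^+ 2 :> R by rewrite sqr_ge0.
rewrite -dE; nra.
Qed.

(** Each contraction multiplies the constant by [pi^2 / 16 < 1], so iteration gets below any [d]. *)
Lemma quadratically_bounded_small {R : realType} (E : nat -> R) :
  (forall d, 0 < d -> quadratically_bounded
     (fun n => \sum_(j < uphalf n) E (n %/ (2 * j + 1))%N) d) ->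
  quadratically_bounded E 1 ->
  forall d, 0 < d -> quadratically_bounded E d.
Proof.
move=> H B1 d d0; set r : R := pi ^+ 2 / 16.
have p0 : 0 < pi :> R := pi_gt0 R.
have p4 : pi < 4 :> R by have := @pihalf_lt2 R; lra.
have r0 : 0 < r by rewrite /r divr_gt0// exprn_gt0.
have r1 : r < 1 by rewrite /r ltr_pdivrMr//; nra.
have Br k : quadratically_bounded E (r ^+ k).
  elim: k => [|k IH]; first by rewrite expr0.
  by rewrite exprS; apply: quadratically_bounded_contract; rewrite ?exprn_gt0.
have [k rk] : exists k, r ^+ k < d.
  have rn : `|r| < 1 by rewrite gtr0_norm.
  have /cvgrPdist_lt/(_ d d0) := cvg_expr rn.
  move=> [k _ /(_ k (leqnn k))] /=; rewrite sub0r normrN gtr0_norm ?exprn_gt0// => h.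
  by exists k.
have [K hK] := Br k; exists K => n; apply: le_trans (hK n) _.
by rewrite lerD2r ler_wpM2r ?sqr_ge0// ltW.
Qed.

Lemma coprime_pairs_quadratic {R : realType} (d : R) : 0 < d ->
  quadratically_bounded
    (fun n => #|coprime_pairs n|%:R - n%:R ^+ 2 / pi ^+ 2) d.
Proof.
have p0 : 0 < pi :> R := pi_gt0 R.
have p2 : 2 <= pi :> R := pi_ge2 R.
have pp : 0 < pi ^+ 2 :> R by rewrite exprn_gt0.
have ip0 : 0 < (pi ^+ 2 : R)^-1 by rewrite invr_gt0.
have ip1 : (pi ^+ 2 : R)^-1 <= 1 by rewrite invf_le1//; nra.
have P2 n : 8 * #|odd_pairs n|%:R <= n%:R ^+ 2 + 1 :> R /\
    n%:R ^+ 2 <= 8 * #|odd_pairs n|%:R + 2 * n%:R :> R.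
  have := card_odd_pairs n; move: #|odd_pairs n| => c h.
  have h8 : (8 * c <= n * n + 1 /\ n * n <= 8 * c + 2 * n)%N.
    have [e|e] : n = (uphalf n + uphalf n)%N \/ (n.+1 = uphalf n + uphalf n)%N by lia.
      by move: h e; move: (uphalf n) => t h e; subst n; nia.
    by move: h e; move: (uphalf n) => t h e; nia.
  case: h8 => h1 h2; split.
    by move: h1; rewrite -(ler_nat R) natrM natrD natrM expr2.
  by move: h2; rewrite -(ler_nat R) natrD natrM [(8 * c)%N%:R]natrM [(2 * n)%N%:R]natrM expr2.
apply: quadratically_bounded_small => [e e0|].
  have [K hK] := @sum_divn_sqr R (e / 2) ltac:(lra).
  exists (K + 1 + 1 ^+ 2 / (4 * (e / 2))) => n.
  rewrite sumrB -natr_sum -mulr_suml.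
  have -> : (\sum_(j < uphalf n) #|coprime_pairs (n %/ (2 * j + 1))|)%N = #|odd_pairs n|.
    rewrite card_odd_pairs_gcd.
    by rewrite (sum_odd_ord n (fun d => #|coprime_pairs (n %/ d)|)).
  have := hK n; set S := \sum_(j < _) _ => hS.
  have [h1 h2] := P2 n.
  have l := @linear_le_quadratic R (e / 2) 1 n%:R ltac:(lra).
  have b1 : `|#|odd_pairs n|%:R - n%:R ^+ 2 / 8| <= n%:R + 1 :> R.
    have n0 : 0 <= n%:R :> R by rewrite ler0n.
    by rewrite ler_norml; apply/andP; split; lra.
  have b2 : `|(S - n%:R ^+ 2 * (pi ^+ 2 / 8)) / pi ^+ 2| <= e / 2 * n%:R ^+ 2 + K.
    rewrite normrM (gtr0_norm ip0); apply: le_trans hS.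
    by rewrite ler_piMr.
  (* Both parts are compared with the common main term [n^2 / 8]: the count of all pairs, and the
     sum of squared quotients over [pi^2]. *)
  have -> : #|odd_pairs n|%:R - S / pi ^+ 2 = (#|odd_pairs n|%:R - n%:R ^+ 2 / 8) -
      (S - n%:R ^+ 2 * (pi ^+ 2 / 8)) / pi ^+ 2 :> R.
    by move: (pi ^+ 2 : R) pp => q q0; field; rewrite gt_eqF.
  apply: le_trans (ler_normB _ _) _.
  move: b1 b2 l; rewrite !mul1r; lra.
exists 1 => n.
have le : #|coprime_pairs n|%:R <= #|odd_pairs n|%:R :> R.
  by rewrite ler_nat subset_leq_card//; apply/fintype.subsetP => x; rewrite inE => /andP[].
have [h1 _] := P2 n.
have n2 : 0 <= n%:R ^+ 2 :> R by rewrite sqr_ge0.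
have v0 : 0 <= #|coprime_pairs n|%:R :> R by rewrite ler0n.
have u0 : 0 <= n%:R ^+ 2 / pi ^+ 2 :> R by rewrite divr_ge0// ltW.
have u1 : n%:R ^+ 2 / pi ^+ 2 <= n%:R ^+ 2 :> R by rewrite ler_piMr.
rewrite ler_norml; apply/andP; split; lra.
Qed.

Lemma coprime_pairs_asymp {R : realType} :
  asymp_equiv \oo (fun n => #|coprime_pairs n|%:R : R)
    (fun n => n%:R ^+ 2 / pi ^+ 2).
Proof.
rewrite /asymp_equiv; apply/cvgrPdist_le => e e0.
have p0 : 0 < pi :> R := pi_gt0 R.
have pp : 0 < pi ^+ 2 :> R by rewrite exprn_gt0.
(* After division by [n^2 / pi^2] this costs [e / 2]; the constant [K] costs the other half once
   [n >= 2 pi^2 K / e]. *)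
have d0 : 0 < e / (2 * pi ^+ 2) by rewrite divr_gt0// mulr_gt0.
have [K hK] := coprime_pairs_quadratic _ d0.
near=> n.
have n0 : (0 < n)%N by near: n; exact: nbhs_infty_gt.
have nK : 2 * pi ^+ 2 * K / e <= n%:R by near: n; exact: nbhs_infty_ger.
have n1 : 1 <= n%:R :> R by rewrite ler1n.
have n2 : 0 < n%:R ^+ 2 :> R by rewrite exprn_gt0//; lra.
have -> : 1 - #|coprime_pairs n|%:R / (n%:R ^+ 2 / pi ^+ 2) =
  - (#|coprime_pairs n|%:R - n%:R ^+ 2 / pi ^+ 2) * (pi ^+ 2 / n%:R ^+ 2) :> R.
  move: (pi ^+ 2 : R) pp (n%:R ^+ 2 : R) n2 => q q0 s s0.
  by field; rewrite !gt_eqF.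
rewrite normrM normrN [X in _ * X]gtr0_norm; last by rewrite divr_gt0.
rewrite mulrA ler_pdivrMr// -ler_pdivlMr//.
apply: le_trans (hK n) _.
rewrite ler_pdivlMr//.
have -> : (e / (2 * pi ^+ 2) * n%:R ^+ 2 + K) * pi ^+ 2 =
   e / 2 * n%:R ^+ 2 + pi ^+ 2 * K :> R.
  by move: (pi ^+ 2 : R) pp => q q0; field; rewrite gt_eqF.
have : pi ^+ 2 * K <= e / 2 * n%:R.
  by move: nK; rewrite ler_pdivrMr// => nK; lra.
have : n%:R <= n%:R ^+ 2 :> R by nra.
nra.
Unshelve. all: by end_near. Qed.

(** * Critical values as reduced fractions *)

Definition winding_ratio {R : realType} {n : nat} (x : 'I_n.+1 * 'I_n.+1) : R :=
  pi *+ 2 *+ x.1 / x.2%:R.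

Lemma winding_ratioE {R : realType} (k s k' s' : nat) : (0 < s)%N -> (0 < s')%N ->
  pi *+ 2 *+ k / s%:R = pi *+ 2 *+ k' / s'%:R :> R -> (k * s' = k' * s)%N.
Proof.
move=> s0 s0' /eqP; rewrite eqr_div ?pnatr_eq0 -?lt0n// -!(mulr_natr (pi *+ 2)).
have p0 : pi *+ 2 != 0 :> R by rewrite gt_eqF// pmulrn_lgt0// pi_gt0.
by rewrite -!mulrA -!natrM => /eqP/(mulfI p0)/eqP; rewrite eqr_nat => /eqP.
Qed.

Lemma winding_ratio_inj {R : realType} {n : nat} :
  {in coprime_pairs n &, injective (fun x => winding_ratio x : R)}.
Proof.
move=> [k s] [k' s']; rewrite !inE /= => /andP[/and3P[sodd k0 ks] cks].
move=> /andP[/and3P[sodd' k0' ks'] cks'] /winding_ratioE/= h.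
have {h} e : (k * s' = k' * s)%N by apply: h; apply: leq_ltn_trans (leq0n _) _; eassumption.
have ss : (s : nat) = s'.
  apply/eqP; rewrite eqn_dvd; apply/andP; split.
    by rewrite -(Gauss_dvdr _ (_ : coprime s k)) 1?coprime_sym// e dvdn_mull.
  by rewrite -(Gauss_dvdr _ (_ : coprime s' k')) 1?coprime_sym// -e dvdn_mull.
have s0 : (0 < s)%N by exact: odd_gt0.
move: e; rewrite -ss => /eqP; rewrite eqn_pmul2r// => /eqP kk.
by congr (_, _); exact: val_inj.
Qed.

Lemma Vn_coprime_pairs {R : realType} {n : nat} : odd n -> (2 < n)%N ->
  Vn R n = [set winding_ratio x | x in [set` coprime_pairs n]].
Proof.
move=> no n2; rewrite VnE//; apply/seteqP; split=> r [].
  move=> [A k]; rewrite /= inE /= => /and3P[hA k0 kw] <-.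
  set w := winding_sum A in kw.
  have wn : (w <= n)%N by rewrite leq_subr.
  have w0 : (0 < w)%N by rewrite (leq_ltn_trans _ kw).
  have wo : odd w by rewrite oddB ?oddM ?no// ltnW.
  set g := gcdn k w.
  have g0 : (0 < g)%N by rewrite gcdn_gt0 k0.
  have gk : (g * (k %/ g) = k)%N by rewrite mulnC divnK// dvdn_gcdl.
  have gw : (g * (w %/ g) = w)%N by rewrite mulnC divnK// dvdn_gcdr.
  have kl : (k %/ g < n.+1)%N by rewrite ltnS (leq_trans (leq_div _ _))// ltnW.
  have wl : (w %/ g < n.+1)%N by rewrite ltnS (leq_trans (leq_div _ _)).
  exists (Ordinal kl, Ordinal wl).
    rewrite /= !inE /=; apply/andP; split; last first.
      by rewrite /coprime -(eqn_pmul2l g0) muln1 muln_gcdr gk gw.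
    apply/and3P; split.
    - by move: wo; rewrite -{1}gw oddM => /andP[].
    - by rewrite divn_gt0// dvdn_leq// dvdn_gcdl.
    - by rewrite -(ltn_pmul2l g0) mulnCA gk gw.
  rewrite /winding_ratio /side /= -/w -[in RHS]gk -[in RHS]gw.
  have gR : g%:R != 0 :> R by rewrite pnatr_eq0 -lt0n.
  have wR : (w %/ g)%N%:R != 0 :> R.
    by rewrite pnatr_eq0 -lt0n divn_gt0// dvdn_leq// dvdn_gcdr.
  rewrite -!(mulr_natr (pi *+ 2)) !natrM.
  move: (pi *+ 2 : R) (g%:R : R) ((w %/ g)%N%:R : R) ((k %/ g)%N%:R : R) gR wR => p a b c a0 b0.
  by field; rewrite a0 b0.
move=> [k s]; rewrite /= !inE /= => /andP[/and3P[sodd k0 ks] _] <-.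
have sn : (s <= n)%N by rewrite -ltnS.
have hn : ((n - s)./2 <= n)%N by lia.
(* Since [n] and [s] are both odd, [n - s] is even, and any [(n - s) / 2] clockwise edges produce
   winding sum exactly [s]. *)
pose A : {set 'I_n} := [set i : 'I_n | (i < (n - s)./2)%N]%SET.
have cA : #|A| = (n - s)./2.
  rewrite cardsE -sum1_card big_mkcond /=.
  rewrite -(big_mkord xpredT (fun i => if (i < (n - s)./2)%N then 1%N else 0%N)).
  rewrite (big_cat_nat (n := (n - s)./2)) //=.
  rewrite [X in (_ + X)%N]big_nat_cond [X in (_ + X)%N]big1 ?addn0; last first.
    by move=> i; rewrite andbT => /andP[h _]; case: ifP => //; lia.
  rewrite big_nat_cond (eq_bigr (fun=> 1%N)); last first.
    by move=> i; rewrite andbT => /andP[_ ->].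
  by rewrite -big_nat_cond sum_nat_const_nat muln1 subn0.
have wA : winding_sum A = s by rewrite /winding_sum cA; lia.
have kn : (k < n)%N by lia.
exists (A, Ordinal kn).
  by rewrite /= inE /= wA cA k0 ks /= andbT; lia.
by rewrite /side /winding_ratio /= wA.
Qed.

Lemma card_Vn {R : realType} {n : nat} : odd n -> (2 < n)%N ->
  setcard (Vn R n) = #|coprime_pairs n|.
Proof.
by move=> no n2; rewrite Vn_coprime_pairs// setcard_image//; exact: winding_ratio_inj.
Qed.

Theorem corollaryD (R : realType) :
  asymp_equiv \oo
    (fun m : nat => (setcard (Un R (2 * m + 1)%N))%:R : R)
    (fun m : nat => 2 ^+ (2 * m - 1)%N *
       (-1 + (2 * m + 1)%N%:R / Num.sqrt (pi * m%:R)))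
  /\
  asymp_equiv (within [set n : nat | odd n] \oo)
    (fun n : nat => (setcard (Vn R n))%:R : R)
    (fun n : nat => n%:R ^+ 2 / pi ^+ 2).
Proof.
split; first exact: critical_count_asymp.
have h : (fun n => #|coprime_pairs n|%:R / (n%:R ^+ 2 / pi ^+ 2) : R)
    @ within [set n : nat | odd n] \oo --> (1 : R).
  exact: cvg_within_filter coprime_pairs_asymp.
apply: cvg_trans h; apply: near_eq_cvg.
rewrite near_withinE; near=> n => no /=.
by rewrite card_Vn//; near: n; exact: nbhs_infty_gt.
Unshelve. all: by end_near. Qed.
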